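(* Let $G$ be a locally compact Hausdorff group equipped with a left-invariant or right-invariant $\sigma$-finite Borel measure $\mu$, and let $1\leq p<\infty$. Then $S_p(G)\neq\{0\}$ if and only if $\mu$ is a positive scalar multiple of the counting measure and $G$ is a countable group.
   Context: All spaces are over $\mathbb{C}$. For a Hilbert space $\mathcal{H}$ and $1\leq p<\infty$, $S_p(\mathcal{H})$ denotes the $p$-th Schatten class, i.e. the set of bounded (compact) operators $T$ on $\mathcal{H}$ with $\|T\|_p=\big(\sum_{n\geq 1}s_n(T)^p\big)^{1/p}<\infty$, where $s_1(T)\geq s_2(T)\geq\dots\geq 0$ are the singular values of $T$. Let $\pi:L^\infty(G)\to B(L^2(G))$ (both spaces taken with respect to $\mu$) be the representation by multiplication, $\pi(f)g=f\cdot g$ for $f\in L^\infty(G)$, $g\in L^2(G)$. Define $S_p(G)=\pi^{-1}\big(S_p(L^2(G))\big)=\{f\in L^\infty(G): \pi(f)\in S_p(L^2(G))\}$. Countable includes finite. *)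

(* Defs.v *)
From HB Require Import structures.
From mathcomp Require Import all_boot all_order all_algebra.
From mathcomp Require Import complex.
From mathcomp Require Import all_classical all_reals all_analysis.
From mathcomp Require Import measurable_realfun ess_sup_inf.
From mathcomp Require Import ring_quotient generic_quotient.
From mathcomp Require Import ring.

Set Implicit Arguments.
Unset Strict Implicit.
Unset Printing Implicit Defensive.
Import Order.TTheory GRing.Theory Num.Theory.
Import numFieldNormedType.Exports.
Import ComplexField.Normc.

Local Open Scope classical_set_scope.
Local Open Scope complex_scope.
Local Open Scope quotient_scope.
Local Open Scope ring_scope.

Section complex_measurable.
Context d (T : measurableType d) (R : realType).
Implicit Types f g : T -> R[i].

Definition cmeasurable f :=
  measurable_fun [set: T] (fun x => complex.Re (f x)) /\
  measurable_fun [set: T] (fun x => complex.Im (f x)).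

Lemma cmeasurable_cst (c : R[i]) : cmeasurable (cst c).
Proof. by split; exact: measurable_cst. Qed.

Lemma cmeasurableD f g :
  cmeasurable f -> cmeasurable g -> cmeasurable (fun x => f x + g x).
Proof.
move=> [f1 f2] [g1 g2]; split.
- rewrite (_ : (fun _ => _) = (fun x => complex.Re (f x)) \+ (fun x => complex.Re (g x))).
    exact: measurable_funD.
  by apply/funext => x /=; case: (f x) (g x) => [? ?] [? ?].
- rewrite (_ : (fun _ => _) = (fun x => complex.Im (f x)) \+ (fun x => complex.Im (g x))).
    exact: measurable_funD.
  by apply/funext => x /=; case: (f x) (g x) => [? ?] [? ?].
Qed.

Lemma cmeasurableM f g :
  cmeasurable f -> cmeasurable g -> cmeasurable (fun x => f x * g x).
Proof.
move=> [f1 f2] [g1 g2]; split.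
- rewrite (_ : (fun _ => _) = ((fun x => complex.Re (f x)) \* (fun x => complex.Re (g x)))
      \- ((fun x => complex.Im (f x)) \* (fun x => complex.Im (g x)))).
    by apply: measurable_funB; exact: measurable_funM.
  by apply/funext => x /=; case: (f x) (g x) => [? ?] [? ?].
- rewrite (_ : (fun _ => _) = ((fun x => complex.Re (f x)) \* (fun x => complex.Im (g x)))
      \+ ((fun x => complex.Im (f x)) \* (fun x => complex.Re (g x)))).
    by apply: measurable_funD; exact: measurable_funM.
  by apply/funext => x /=; case: (f x) (g x) => [? ?] [? ?].
Qed.

Lemma cmeasurableJ f : cmeasurable f -> cmeasurable (fun x => (f x)^*).
Proof.
move=> [f1 f2]; split.
- by rewrite (_ : (fun _ => _) = (fun x => complex.Re (f x))) //;
    apply/funext => x /=; case: (f x).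
- rewrite (_ : (fun _ => _) = \- (fun x => complex.Im (f x))).
    exact: measurableT_comp.
  by apply/funext => x /=; case: (f x).
Qed.

Lemma cmeasurable_normc f :
  cmeasurable f -> measurable_fun [set: T] (fun x => normc (f x)).
Proof.
move=> [f1 f2].
rewrite (_ : (fun _ => _) =
    @Num.sqrt R \o (fun x => complex.Re (f x) ^+ 2 + complex.Im (f x) ^+ 2)); last first.
  by apply/funext => x /=; case: (f x).
apply: measurableT_comp.
  exact: (continuous_measurable_fun (@sqrt_continuous R)).
by apply: measurable_funD; exact: measurable_funX.
Qed.

End complex_measurable.


Section Lnorm_mono.
Context d (T : measurableType d) (R : realType) (mu : {measure set T -> \bar R}).
Local Open Scope ereal_scope.

Lemma ae_le_Lnorm p (u v : T -> R) : 1 <= p ->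
  measurable_fun [set: T] u -> measurable_fun [set: T] v ->
  (forall x, 0 <= u x)%R -> (\forall x \ae mu, (u x <= v x)%R) ->
  'N[mu]_p[EFin \o u] <= 'N[mu]_p[EFin \o v].
Proof.
move=> p1 mu_ mv u0 uv.
have pow_meas (w : T -> R) r : measurable_fun [set: T] w ->
    measurable_fun [set: T] (fun x => (`|w x| `^ r)%:E).
  move=> mw; apply/measurable_EFinP.
  apply: (measurableT_comp (measurable_powR _)).
  exact: measurableT_comp.
case: p p1 => [r r1|_|//]; rewrite unlock /Lnorm.
- have r0 : (0 < r)%R by rewrite -lte_fin; apply: lt_le_trans r1.
  apply: gt0_ler_poweR; rewrite ?in_itv/= ?leey ?andbT ?invr_ge0 ?(ltW r0)//.
  + by rewrite integral_ge0// => x _; exact: poweR_ge0.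
  + by rewrite integral_ge0// => x _; exact: poweR_ge0.
  apply: ae_ge0_le_integral => //.
  + exact: pow_meas.
  + exact: pow_meas.
  + apply: filterS uv => x uvx _ /=; rewrite lee_fin.
    rewrite ge0_ler_powR ?nnegrE// ?(ltW r0)// !ger0_norm//.
    exact: le_trans uvx.
- case: ifPn => // _; apply: le_ess_sup; apply: filterS uv => x uvx /=.
  by rewrite lee_fin !ger0_norm//; exact: le_trans uvx.
Qed.

Lemma LnormZ_ge0 p (p1 : 1 <= p) (u : T -> R) a : (0 <= a)%R ->
  measurable_fun [set: T] u -> 'N[mu]_p[EFin \o u] < +oo ->
  'N[mu]_p[EFin \o (fun x => a * u x)%R] = a%:E * 'N[mu]_p[EFin \o u].
Proof.
move=> a0 mu_ fu.
have uL : u \in Lfun mu p by rewrite inE; apply/andP; split; rewrite inE.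
by have := LnormZ (Lfun_Sub p1 uL) a; rewrite (ger0_norm a0).
Qed.

End Lnorm_mono.

Section complex_Lp.
Context d (T : measurableType d) (R : realType) (mu : {measure set T -> \bar R}).
Variables (p : \bar R) (p1 : (1 <= p)%E).
Local Open Scope ereal_scope.

Definition cLnorm (f : T -> R[i]) : \bar R := 'N[mu]_p[EFin \o (fun x => normc (f x))].

Definition cLfun (_ : 1 <= p) : {pred T -> R[i]^o} :=
  mem [set f : T -> R[i]^o | cmeasurable f /\ cLnorm f < +oo].

Lemma cLfunP f : reflect (cmeasurable f /\ cLnorm f < +oo) (f \in cLfun p1).
Proof. by apply: (iffP idP) => [|fP]; rewrite inE. Qed.

Lemma cLnorm_ge0 f : 0 <= cLnorm f. Proof. exact: Lnorm_ge0. Qed.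

Lemma cLnorm0 : cLnorm (cst 0%R) = 0.
Proof.
rewrite /cLnorm (_ : EFin \o _ = cst 0); last first.
  by apply/funext => x /=; rewrite expr0n addr0 sqrtr0.
by rewrite Lnorm0// gt_eqF// (lt_le_trans _ p1).
Qed.

Lemma normc_ge0 (z : R[i]) : (0 <= normc z)%R.
Proof. by case: z => a b /=; rewrite sqrtr_ge0. Qed.

Lemma ae_le_cLnorm f g : cmeasurable f -> cmeasurable g ->
  (\forall x \ae mu, (normc (f x) <= normc (g x))%R) -> cLnorm f <= cLnorm g.
Proof.
move=> mf mg fg; apply: ae_le_Lnorm => //; try exact: cmeasurable_normc.
by move=> x; exact: normc_ge0.
Qed.

Lemma ae_eq_cLnorm f g : cmeasurable f -> cmeasurable g ->
  (\forall x \ae mu, f x = g x) -> cLnorm f = cLnorm g.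
Proof.
move=> mf mg fg; apply/eqP; rewrite eq_le; apply/andP; split;
  by apply: ae_le_cLnorm => //; apply: filterS fg => x ->.
Qed.

Lemma le_cLnormD f g : cmeasurable f -> cmeasurable g ->
  cLnorm (fun x => f x + g x)%R <= cLnorm f + cLnorm g.
Proof.
move=> mf mg; have nf := cmeasurable_normc mf; have ng := cmeasurable_normc mg.
apply: le_trans (eminkowski mu nf ng p1).
apply: ae_le_Lnorm => //.
- exact/cmeasurable_normc/cmeasurableD.
- exact: measurable_funD.
- by move=> x; exact: normc_ge0.
- by apply/nearW => x; exact: le_normcD.
Qed.

Lemma cLnormZ f (c : R[i]) : cmeasurable f -> cLnorm f < +oo ->
  cLnorm (fun x => c * f x)%R = (normc c)%:E * cLnorm f.
Proof.
move=> mf ff; rewrite /cLnorm.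
rewrite -(LnormZ_ge0 p1 _ (cmeasurable_normc mf) ff) ?normc_ge0//.
by apply: eq_Lnorm => x /=; rewrite normcM.
Qed.

Lemma cLnorm_eq0 f : cmeasurable f -> cLnorm f = 0 -> \forall x \ae mu, f x = 0%R.
Proof.
move=> mf f0; have p0 : 0 < p by exact: lt_le_trans p1.
have mn : measurable_fun [set: T] (fun x => (normc (f x))%:E).
  exact/measurable_EFinP/cmeasurable_normc.
have := Lnorm_eq0_eq0 mn p0 f0; apply: filterS => x /(_ I) [].
exact: eq0_normc.
Qed.

Lemma cLfun_submod_closed : submod_closed (cLfun p1).
Proof.
split; first by apply/cLfunP; split; [exact: cmeasurable_cst|rewrite cLnorm0].
move=> a f g /cLfunP[mf ff] /cLfunP[mg fg]; apply/cLfunP.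
have maf : cmeasurable (fun x => a * f x)%R.
  by apply: cmeasurableM => //; exact: cmeasurable_cst.
split; first exact: cmeasurableD.
apply: le_lt_trans (le_cLnormD maf mg) _.
by rewrite lte_add_pinfty// cLnormZ// lte_mul_pinfty// lee_fin normc_ge0.
Qed.

HB.instance Definition _ :=
  GRing.isSubmodClosed.Build _ _ (cLfun p1) cLfun_submod_closed.

Record cLfunType := CLfun {
  cLfun_fun :> T -> R[i]^o ;
  cLfun_subproof : cLfun_fun \in cLfun p1 }.

HB.instance Definition _ := [isSub for cLfun_fun].
HB.instance Definition _ := [Choice of cLfunType by <:].
HB.instance Definition _ := [SubChoice_isSubLmodule of cLfunType by <:].

Definition cLnull : {pred cLfunType} :=
  mem [set f : cLfunType | \forall x \ae mu, f x = 0%R].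

Lemma cLnull_zmod_closed : zmod_closed cLnull.
Proof.
split; first by rewrite inE; exact/nearW.
move=> f g; rewrite !inE /= => f0 g0.
apply: filterS2 f0 g0 => x fx gx.
suff: (f x - g x = 0)%R by [].
by rewrite fx gx subr0.
Qed.

HB.instance Definition _ :=
  GRing.isZmodClosed.Build _ cLnull cLnull_zmod_closed.

Definition cLspace : Type := Quotient.quot cLnull.
HB.instance Definition _ := Choice.on cLspace.
HB.instance Definition _ := GRing.Zmodule.on cLspace.


Lemma cLspaceP (f g : cLfunType) :
  \pi_cLspace f = \pi_cLspace g <-> \forall x \ae mu, f x = g x.
Proof.

rewrite (rwP eqP) -Quotient.idealrBE inE /=; split; apply: filterS => x.
  by move=> h; apply/eqP; rewrite -subr_eq0; apply/eqP.
by move=> h; suff: (f x - g x = 0)%R by []; rewrite h subrr.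
Qed.

Lemma repr_ae (f : cLfunType) : \forall x \ae mu, repr (\pi_cLspace f) x = f x.
Proof. by apply/cLspaceP; rewrite reprK. Qed.

Definition cLscale (a : R[i]) := lift_op1 cLspace (fun f : cLfunType => a *: f)%R.

Lemma pi_cLscale a : {morph \pi_cLspace : f / (a *: f)%R >-> cLscale a f}.
Proof.
move=> f; unlock cLscale; apply/cLspaceP; apply: filterS (repr_ae f) => x fx.
by suff: (a * f x = a * repr (\pi_cLspace f) x)%R by []; rewrite fx.
Qed.

Lemma pi_cLD : {morph \pi_cLspace : f g / (f + g)%R >-> (f + g)%R}.
Proof. by move=> f g; rewrite piE. Qed.

Lemma cLscaleA a b (q : cLspace) : cLscale a (cLscale b q) = cLscale (a * b)%R q.
Proof. by rewrite -[q]reprK -!pi_cLscale scalerA. Qed.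

Lemma cLscale1 : left_id 1%R cLscale.
Proof. by move=> q; rewrite -[q]reprK -!pi_cLscale scale1r. Qed.

Lemma cLscaleDr : right_distributive cLscale +%R.
Proof.
by move=> a q r; rewrite -[q]reprK -[r]reprK -pi_cLD -!pi_cLscale -pi_cLD scalerDr.
Qed.

Lemma cLscaleDl q : {morph cLscale^~ q : a b / (a + b)%R}.
Proof. by move=> a b; rewrite -[q]reprK -!pi_cLscale -pi_cLD scalerDl. Qed.

HB.instance Definition _ := GRing.Zmodule_isLmodule.Build R[i] cLspace
  cLscaleA cLscale1 cLscaleDr cLscaleDl.

Lemma pi_cL_linear a (f g : cLfunType) :
  (\pi_cLspace (a *: f + g) =
   a *: (\pi_cLspace f : cLspace) + (\pi_cLspace g : cLspace))%R.
Proof. by rewrite pi_cLD pi_cLscale. Qed.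

Lemma cLspaceZE a (f : cLfunType) :
  (a *: (\pi_cLspace f : cLspace) = \pi_cLspace (a *: f))%R.
Proof. by rewrite pi_cLscale. Qed.

Lemma cLmeas (f : cLfunType) : cmeasurable f.
Proof. by have /cLfunP[] := valP f. Qed.

Lemma cLfin (f : cLfunType) : cLnorm f < +oo.
Proof. by have /cLfunP[] := valP f. Qed.

Lemma cLfin_num (f : cLfunType) : cLnorm f \is a fin_num.
Proof. by rewrite ge0_fin_numE ?cLnorm_ge0 ?cLfin. Qed.

Definition cLspace_norm (q : cLspace) : R[i] := (fine (cLnorm (repr q)))%:C.

Lemma cLspace_normE (f : cLfunType) :
  cLspace_norm (\pi_cLspace f) = (fine (cLnorm f))%:C.
Proof.
congr (fine _)%:C; apply: ae_eq_cLnorm; [exact: cLmeas|exact: cLmeas|].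
exact: repr_ae.
Qed.

Lemma cLspace_ler_normD q r :
  (cLspace_norm (q + r) <= cLspace_norm q + cLspace_norm r)%R.
Proof.
rewrite -[q]reprK -[r]reprK -pi_cLD !cLspace_normE -rmorphD lecR.
rewrite -lee_fin EFinD !fineK ?cLfin_num//.
by apply: le_cLnormD; exact: cLmeas.
Qed.

Lemma cLspace_normrZ (a : R[i]) q :
  (cLspace_norm (a *: q) = `|a| * cLspace_norm q)%R.
Proof.
rewrite -[q]reprK cLspaceZE !cLspace_normE (_ : `|a|%R = (normc a)%:C)//.
rewrite -rmorphM; congr _%:C; apply: EFin_inj.
rewrite EFinM !fineK ?cLfin_num//.
by apply: cLnormZ; [exact: cLmeas|exact: cLfin].
Qed.

Lemma cLspace_normr0_eq0 q : cLspace_norm q = 0%R -> q = 0%R.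
Proof.
rewrite -[q]reprK cLspace_normE => /complexI f0.
have -> : (0 : cLspace)%R = \pi_cLspace (0 : cLfunType)%R by rewrite piE.
apply/cLspaceP/cLnorm_eq0; first exact: cLmeas.
by rewrite -(fineK (cLfin_num _)) f0.
Qed.

HB.instance Definition _ := Lmodule_isNormed.Build R[i] cLspace
  cLspace_ler_normD cLspace_normrZ cLspace_normr0_eq0.

End complex_Lp.

HB.mixin Record NormedModule_hasDot (R : realType) H of NormedModule R[i] H := {
  cdot : H -> H -> R[i] ;
  cdotP : forall a x y z, cdot (a *: x + y) z = a * cdot x z + cdot y z ;
  cdotC : forall x y, cdot y x = (cdot x y)^* ;
  cdotxx : forall x, cdot x x = `|x| ^+ 2 }.

#[short(type="innerProductType")]
HB.structure Definition InnerProduct (R : realType) :=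
  {H of NormedModule R[i] H & NormedModule_hasDot R H}.

Section complex_integral.
Context d (T : measurableType d) (R : realType) (mu : {measure set T -> \bar R}).
Implicit Types f g : T -> R[i].

Definition cintegrable f :=
  mu.-integrable [set: T] (fun x => (complex.Re (f x))%:E) /\
  mu.-integrable [set: T] (fun x => (complex.Im (f x))%:E).

Definition cintegral f : R[i] :=
  (\int[mu]_x complex.Re (f x))%R +i* (\int[mu]_x complex.Im (f x))%R.

Lemma eq_cintegral f g : f =1 g -> cintegral f = cintegral g.
Proof. by move=> /funext ->. Qed.

Lemma ae_eq_cintegral f g : cmeasurable f -> cmeasurable g ->
  (\forall x \ae mu, f x = g x) -> cintegral f = cintegral g.
Proof.
move=> [f1 f2] [g1 g2] fg; congr (fine _ +i* fine _); apply: ae_eq_integral => //;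
  try exact/measurable_EFinP; by apply: filterS fg => x ->.
Qed.

Lemma cintegralD f g : cintegrable f -> cintegrable g ->
  cintegral (fun x => f x + g x) = cintegral f + cintegral g.
Proof.
move=> [f1 f2] [g1 g2]; rewrite /cintegral.
have -> (a b a' b' : R) : (a +i* b) + (a' +i* b') = (a + a') +i* (b + b') by [].
by congr (_ +i* _); rewrite -RintegralD//; apply: eq_Rintegral => x _;
  case: (f x) (g x) => [? ?] [? ?].
Qed.

Lemma cintegralZ c f : cintegrable f ->
  cintegral (fun x => c * f x) = c * cintegral f.
Proof.
move=> [f1 f2]; case: c => a b; rewrite /cintegral.
have -> (a' b' : R) : (a +i* b) * (a' +i* b') =
  (a * a' - b * b') +i* (a * b' + b * a') by [].
have Z u k : mu.-integrable [set: T] (fun x => (u x)%:E) ->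
    mu.-integrable [set: T] (EFin \o (fun x => k * u x)).
  exact: integrableZl.
congr (_ +i* _); rewrite -!RintegralZl//.
  by rewrite -RintegralB ?Z//; apply: eq_Rintegral => x _; case: (f x).
by rewrite -RintegralD ?Z//; apply: eq_Rintegral => x _; case: (f x).
Qed.

Lemma cintegralJ f : cintegrable f ->
  cintegral (fun x => (f x)^*) = (cintegral f)^*.
Proof.
move=> [f1 f2]; rewrite /cintegral /=; congr (_ +i* _).
  by apply: eq_Rintegral => x _; case: (f x).
rewrite -mulN1r -RintegralZl//; apply: eq_Rintegral => x _.
by case: (f x) => a b; rewrite mulN1r.
Qed.

End complex_integral.

Notation L2space mu := (cLspace mu (lee1n 2)).
Notation Linfty mu := (cLspace mu (leey 1)).

Section L2.
Context d (T : measurableType d) (R : realType) (mu : {measure set T -> \bar R}).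
Notation L2 := (L2space mu).
Notation L2fun := (cLfunType mu (lee1n 2)).

Lemma L2_normc (f : L2fun) : (fun x => normc (f x)) \in Lfun mu 2%:E.
Proof.
rewrite inE; apply/andP; split; rewrite inE.
  exact/cmeasurable_normc/cLmeas.
exact: cLfin.
Qed.

Lemma cmeasurable_cdot (f g : L2fun) : cmeasurable (fun x => f x * (g x)^*).
Proof. by apply: cmeasurableM; [|apply: cmeasurableJ]; exact: cLmeas. Qed.

Lemma L2_cintegrable (f g : L2fun) : cintegrable mu (fun x => f x * (g x)^*).
Proof.
have /Lfun1_integrable fgi := Lfun2_mul_Lfun1 (L2_normc f) (L2_normc g).
have [m1 m2] := cmeasurable_cdot f g.
have nJ (z : R[i]) : normc z^* = normc z by case: z => a b /=; rewrite sqrrN.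
have nRe (z : R[i]) : `|complex.Re z| <= normc z.
  by case: z => a b /=; rewrite -sqrtr_sqr ler_sqrt ?lerDl ?sqr_ge0// addr_ge0 ?sqr_ge0.
have nIm (z : R[i]) : `|complex.Im z| <= normc z.
  by case: z => a b /=; rewrite -sqrtr_sqr ler_sqrt ?lerDr ?sqr_ge0// addr_ge0 ?sqr_ge0.
split; apply: le_integrable fgi => //; try exact/measurable_EFinP.
- move=> x _; rewrite /= lee_fin; apply: le_trans (nRe _) _.
  by rewrite normcM nJ ler_norm.
- move=> x _; rewrite /= lee_fin; apply: le_trans (nIm _) _.
  by rewrite normcM nJ ler_norm.
Qed.

Definition L2dot (q r : L2) : R[i] :=
  cintegral mu (fun x => (repr q : L2fun) x * ((repr r : L2fun) x)^*).

Lemma L2dotE (f g : L2fun) : L2dot (\pi_L2 f) (\pi_L2 g) =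
  cintegral mu (fun x => f x * (g x)^*).
Proof.
apply: ae_eq_cintegral; [exact: cmeasurable_cdot|exact: cmeasurable_cdot|].
by apply: filterS2 (repr_ae f) (repr_ae g) => x /= -> ->.
Qed.

Lemma L2dotP a (q r s : L2) : L2dot (a *: q + r) s = a * L2dot q s + L2dot r s.
Proof.
rewrite -[q]reprK -[r]reprK -[s]reprK.
move: (repr q) (repr r) (repr s) => f g h.
rewrite -pi_cL_linear.
rewrite !L2dotE -cintegralZ; last exact: L2_cintegrable.
transitivity (cintegral mu (fun x => a * (f x * (h x)^*) + g x * (h x)^*)).
  by apply: eq_cintegral => x; rewrite mulrA -mulrDl.
apply: cintegralD; last exact: L2_cintegrable.
have := L2_cintegrable (a *: f) h; congr cintegrable; apply/funext => x.
by rewrite mulrA.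
Qed.

Lemma L2dotC (q r : L2) : L2dot r q = (L2dot q r)^*.
Proof.
rewrite -cintegralJ; last exact: L2_cintegrable.
apply: eq_cintegral => x.
case: ((repr q : L2fun) x) ((repr r : L2fun) x) => [a b] [c e].
by apply/eqP; rewrite eq_complex /=; apply/andP; split; apply/eqP; ring.
Qed.

Lemma L2dotxx (q : L2) : L2dot q q = `|q| ^+ 2.
Proof.
rewrite [`|q|](_ : _ = (fine (cLnorm mu 2%:E (repr q)))%:C)// -rmorphXn.
rewrite /L2dot; set f : L2fun := repr q.
have -> : cintegral mu (fun x => f x * (f x)^*) =
    (\int[mu]_x (normc (f x) ^+ 2))%R%:C.
  congr (_ +i* _).
    apply: eq_Rintegral => x _; case: (f x) => a b /=.
    by rewrite sqr_sqrtr ?addr_ge0 ?sqr_ge0// mulrN opprK !expr2.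
  rewrite -[RHS]/(fine 0%E) -(integral0 mu [set: T]); congr fine.
  apply: eq_integral => x _; congr EFin.
  by case: (f x) => a b /=; rewrite mulrN mulrC addNr.
congr _%:C; rewrite -powR_mulrn ?fine_ge0 ?cLnorm_ge0//.
rewrite -fine_poweR /cLnorm poweR_Lnorm// /Rintegral; congr fine.
apply: eq_integral => x _ /=.
by rewrite ger0_norm ?normc_ge0// powR_mulrn ?normc_ge0.
Qed.

HB.instance Definition _ :=
  NormedModule_hasDot.Build R (L2space mu) L2dotP L2dotC L2dotxx.

Notation Linfun := (cLfunType mu (leey 1)).

Lemma Linf_bound (f : Linfun) :
  exists2 M : R, 0 <= M & \forall x \ae mu, normc (f x) <= M.
Proof.
have := cLfin f; rewrite /cLnorm unlock /Lnorm; case: ifPn => [mu0|].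
  set u := (X in ess_sup _ X); move=> uy.
  have u0 : (0 <= ess_sup mu u)%E by apply: ess_sup_gee => //; apply/nearW => x; exact: abse_ge0.
  have uf : ess_sup mu u \is a fin_num by rewrite ge0_fin_numE.
  exists (fine (ess_sup mu u)); first exact: fine_ge0.
  apply: filterS (ess_sup_ge mu u) => x; rewrite -[X in (_ <= X)%E](fineK uf).
  by rewrite /u /= lee_fin ger0_norm ?normc_ge0.
rewrite -leNgt => mu0 _; exists 0 => //; exists [set: T]; split => //.
by apply/eqP; rewrite eq_le mu0 measure_ge0.
Qed.

Lemma mulL_bound (f : Linfun) (g : L2fun) (M : R) : 0 <= M ->
  (\forall x \ae mu, normc (f x) <= M) ->
  (cLnorm mu 2%:E (fun x => f x * g x)%R <= M%:E * cLnorm mu 2%:E g)%E.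
Proof.
move=> M0 fM.
have nM : normc (M%:C : R[i]) = M by rewrite /= expr0n addr0 sqrtr_sqr ger0_norm.
have -> : M%:E = (normc (M%:C : R[i]))%:E by rewrite nM.
rewrite -(cLnormZ (lee1n 2)); [|exact: cLmeas|exact: cLfin].
apply: (ae_le_cLnorm (lee1n 2)).
- by apply: (@cmeasurableM _ _ _ f g); exact: cLmeas.
- apply: (@cmeasurableM _ _ _ (cst _) g); [exact: cmeasurable_cst|exact: cLmeas].
- apply: filterS fM => x fx; rewrite !normcM nM.
  by rewrite ler_wpM2r// normc_ge0.
Qed.

Lemma mulL_subproof (f : Linfun) (g : L2fun) :
  (fun x => f x * g x) \in cLfun mu (lee1n 2).
Proof.
apply/cLfunP; split; first by apply: (@cmeasurableM _ _ _ f g); exact: cLmeas.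
have [M M0 fM] := Linf_bound f; apply: le_lt_trans (mulL_bound g M0 fM) _.
by rewrite lte_mul_pinfty// ?lee_fin//; exact: cLfin.
Qed.

Definition mulLfun (f : Linfun) (g : L2fun) : L2fun := CLfun (mulL_subproof f g).

Definition mulL (f : Linfty mu) (g : L2) : L2 := \pi_L2 (mulLfun (repr f) (repr g)).

Lemma mulLE (f : Linfun) (g : L2fun) :
  mulL (\pi_(Linfty mu) f) (\pi_L2 g) = \pi_L2 (mulLfun f g).
Proof.
by apply/cLspaceP; apply: filterS2 (repr_ae f) (repr_ae g) => x /= -> ->.
Qed.

Lemma mulL_linear (f : Linfty mu) : linear (mulL f).
Proof.
move=> a q r; rewrite -[f]reprK -[q]reprK -[r]reprK -pi_cL_linear !mulLE.
rewrite -pi_cL_linear; congr (\pi_L2 _); apply: val_inj; apply/funext => x /=.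
move: (repr f) (repr q) (repr r) => F Q R'.
by rewrite [LHS]mulrDr; congr (_ + _); rewrite mulrCA.
Qed.

Lemma mulL_bounded (f : Linfty mu) :
  exists M : R, forall g, `|mulL f g| <= M%:C * `|g|.
Proof.
rewrite -[f]reprK; have [M M0 fM] := Linf_bound (repr f); exists M => g.
rewrite -[g]reprK mulLE; have E (h : L2fun) := cLspace_normE h.
rewrite [leLHS]E [X in _ * X]E -rmorphM lecR.
rewrite -lee_fin EFinM !fineK ?cLfin_num//; exact: mulL_bound.
Qed.

End L2.
Section schatten.
Context (R : realType) (H : innerProductType R).

Record boundedOp := BoundedOp {
  bop_fun :> H -> H ;
  bop_linear : linear bop_fun ;
  bop_bounded : exists M : R, forall x, `|bop_fun x| <= M%:C * `|x| }.

Implicit Types S T : boundedOp.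

Definition compact_op T := precompact (T @` [set x | `|x| <= 1]).

Definition adjoint_op T S := forall x y, cdot (T x) y = cdot x (S y).

Definition has_dim (V : set H) (n : nat) :=
  exists e : 'I_n -> H,
    (forall c : 'I_n -> R[i], \sum_i c i *: e i = 0 -> forall i, c i = 0) /\
    V = [set \sum_i c i *: e i | c in [set: 'I_n -> R[i]]].

(* [s] lists the square roots of the eigenvalues of T^* T in nonincreasing
   order, each positive one as often as the dimension of its eigenspace, and is
   padded with zeros. For a compact operator on a Hilbert space, such a sequence
   exists and is unique. *)
Definition singular_values T (s : nat -> R) :=
  exists2 T' : boundedOp, adjoint_op T T' &
    [/\ {homo s : m n / (m <= n)%N >-> n <= m},
        forall n, 0 <= s n &
        forall l : R, 0 < l -> exists2 n : nat,
          has_dim [set x | T' (T x) = (l ^+ 2)%:C *: x] n &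
          ([set k | s k = l] #= `I_n)%card].

Definition schatten (p : R) : set boundedOp :=
  [set T | compact_op T /\ exists2 s : nat -> R, singular_values T s &
    ((\sum_(0 <= n <oo) (s n `^ p)%:E) `^ p^-1 < +oo)%E].

End schatten.

Definition mulLop d (T : measurableType d) (R : realType)
    (mu : {measure set T -> \bar R}) (f : Linfty mu) : boundedOp (L2space mu) :=
  BoundedOp (mulL_linear f) (mulL_bounded f).
Arguments mulLop {d T R} mu f.

Definition schatten_Linfty d (T : measurableType d) (R : realType)
    (mu : {measure set T -> \bar R}) (p : R) : set (Linfty mu) :=
  mulLop mu @^-1` schatten p.
Arguments schatten_Linfty {d T R} mu p _.

HB.mixin Record isTopologicalGroup G of Group G & Topological G := {
  mulg_continuous : continuous (fun xy : G * G => (xy.1 * xy.2)%g) ;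
  invg_continuous : continuous (fun x : G => (x^-1)%g) }.

#[short(type="topologicalGroupType")]
HB.structure Definition TopologicalGroup :=
  {G of Group G & Topological G & isTopologicalGroup G}.

Section borel.
Variable G : topologicalGroupType.

Definition borelType : Type := G.

HB.instance Definition _ := Choice.on borelType.
HB.instance Definition _ := isPointed.Build borelType (1%g : G).

Lemma borelC (A : set borelType) : <<s @open G >> A -> <<s @open G >> (~` A).
Proof. by move=> mA; rewrite -setTD; exact: sigma_algebraCD. Qed.

HB.instance Definition _ := @isMeasurable.Build (sigma_display (@open G))
  borelType <<s @open G >> (@sigma_algebra0 _ setT (@open G)) borelC
  (@sigma_algebra_bigcup _ setT (@open G)).

Context (R : realType).
Variable mu : {measure set borelType -> \bar R}.

Definition left_invariant := forall (g : G) (A : set borelType),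
  measurable A -> mu ((fun x : G => (g * x)%g) @` A) = mu A.

Definition right_invariant := forall (g : G) (A : set borelType),
  measurable A -> mu ((fun x : G => (x * g)%g) @` A) = mu A.

End borel.

(* Main.v *)
(* If multiplication by [f <> 0] is compact, then [mu] has an atom [B]: otherwise
   a set of positive measure on which [|f|] is bounded below would contain an
   infinite sequence of disjoint sets of positive measure, and the images of
   their normalized indicators would be uniformly separated.

   [mu] is not assumed to be regular, so an atom need not be carried by a point,
   and [G] is not assumed to be sigma-compact. Say that [A] is large when
   [B \ A] is null; being large is an ultrafilter condition, stable under
   countable intersections. Let [H] be the set of [h] whose left translations
   preserve large sets. Since [mu] is sigma-finite, [H] has countable index.
   Let [S] be an open sigma-compact subgroup, so that every union of left cosets
   of [S] is open. For [h] in [H], the set of [x] with [h x S = x S] is large, and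
   as [x S x^-1] meets only countably many left cosets of [S], so does [H]. Hence
   [G] is sigma-compact. If [h <> 1] is in [H], take an open neighbourhood [V]
   of 1 with [h V] and [V] disjoint; countably many [V x] cover [G], so some
   [V x] is large, and so is [h V x], which is disjoint from it. Thus [H] is
   trivial and [G] is countable, whence some point has positive measure.

   Conversely, multiplication by the indicator of a point is a rank-one
   orthogonal projection. *)

Require Import Defs.
From HB Require Import structures.
From mathcomp Require Import all_boot all_order all_algebra.
From mathcomp Require Import complex finmap generic_quotient.
From mathcomp Require Import all_classical all_reals all_analysis.
From mathcomp Require Import measurable_realfun ess_sup_inf ring.

Set Implicit Arguments.
Unset Strict Implicit.
Unset Printing Implicit Defensive.
Import Order.TTheory GRing.Theory Num.Theory.
Import numFieldNormedType.Exports.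

Local Open Scope classical_set_scope.
Local Open Scope ring_scope.

(** * Topological groups *)

Lemma continuous_mulgl (G : topologicalGroupType) (g : G) :
  continuous (fun x : G => (g * x)%g).
Proof.
move=> x; apply: (@continuous_comp _ _ _ (fun x : G => (g, x))
  (fun xy : G * G => (xy.1 * xy.2)%g)).
  by apply: cvg_pair; [exact: cvg_cst|exact: cvg_id].
exact: mulg_continuous.
Qed.

Lemma continuous_mulgr (G : topologicalGroupType) (g : G) :
  continuous (fun x : G => (x * g)%g).
Proof.
move=> x; apply: (@continuous_comp _ _ _ (fun x : G => (x, g))
  (fun xy : G * G => (xy.1 * xy.2)%g)).
  by apply: cvg_pair; [exact: cvg_id|exact: cvg_cst].
exact: mulg_continuous.
Qed.

Lemma image_mulgl (G : groupType) (g : G) (A : set G) :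
  (fun x => (g * x)%g) @` A = (fun x => (g^-1 * x)%g) @^-1` A.
Proof.
apply/seteqP; split=> [_ [x Ax <-]|x Ax] /=; first by rewrite mulKg.
by exists (g^-1 * x)%g => //; rewrite mulVKg.
Qed.

(** * Sigma-compact sets and countable subcovers *)

Definition sigma_compact (T : topologicalType) (S : set T) :=
  exists2 K : nat -> set T, (forall n, compact (K n)) & S = \bigcup_n K n.

Lemma compact_countable_cover (T : topologicalType) (K : set T) (F : T -> set T) :
  compact K -> (forall x, open (F x)) -> (forall x, F x x) ->
  exists2 D : set T, countable D & K `<=` \bigcup_(x in D) F x.
Proof.
move=> cK oF Fx; have [->|/set0P[x0 _]] := eqVneq K set0; first by exists set0.
pose T' : ptopologicalType := HB.pack (T : Type) (Topological.on T)
  (isPointed.Build T x0).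
have := cK; rewrite [compact](@compact_cover T') => /(_ T setT F)[].
- by move=> i _; exact: oF.
- by move=> x _; exists x.
- by move=> D _ KD; exists [set` D] => //; exact: countable_fset.
Qed.

Lemma sigma_compact_cover (T : topologicalType) (S : set T) (F : T -> set T) :
  sigma_compact S -> (forall x, open (F x)) -> (forall x, F x x) ->
  exists2 D : set T, countable D & S `<=` \bigcup_(x in D) F x.
Proof.
move=> [K cK ->] oF Fx.
have /choice[D DP] n : exists D : set T, countable D /\ K n `<=` \bigcup_(x in D) F x.
  by have [D cD KD] := compact_countable_cover (cK n) oF Fx; exists D.
exists (\bigcup_n D n).
  by apply: bigcup_countable => // n _; case: (DP n).
move=> x [n _ /(proj2 (DP n))[y Dy Fy]]; exists y => //.
by exists n.
Qed.

(* The union of the powers of a symmetric compact neighbourhood of 1. *)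
Lemma open_sigma_compact_subgroup (G : topologicalGroupType) :
  locally_compact [set: G] ->
  exists S : set G, [/\ S 1%g, forall x y, S x -> S y -> S (x^-1 * y)%g,
                        open S & sigma_compact S].
Proof.
move=> /(_ 1%g I) [K]; rewrite withinET => nK [cK _].
pose L := K `|` (fun x : G => x^-1%g) @` K.
have cL : compact L.
  apply: compactU => //; apply: continuous_compact => //.
  by apply: continuous_subspaceT; exact: invg_continuous.
have LV x : L x -> L (x^-1)%g.
  by case=> [Kx|[y Ky <-]]; [right; exists x|left; rewrite invgK].
pose P := fix P n : set G := if n is n.+1 then
  (fun xy : G * G => (xy.1 * xy.2)%g) @` (P n `*` L) else [set 1%g].
have cP n : compact (P n).
  elim: n => [|n IH] /=; first exact: compact_set1.
  apply: continuous_compact; last exact: compact_setX.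
  by apply: continuous_subspaceT; exact: mulg_continuous.
have PM m n x y : P m x -> P n y -> P (m + n)%N (x * y)%g.
  elim: n x y => [|n IH] x y Px /=; first by move=> ->; rewrite addn0 mulg1.
  move=> [[a b] [/= Pa Lb] <-]; rewrite addnS /=; exists (x * a, b)%g => /=.
    by split => //; exact: IH.
  by rewrite mulgA.
have P1 x : L x -> P 1%N x by move=> Lx; exists (1%g, x) => //=; rewrite mul1g.
have PV n x : P n x -> P n (x^-1)%g.
  elim: n x => [|n IH] x /=; first by move=> ->; rewrite invg1.
  move=> [[a b] [/= Pa Lb] <-]; rewrite invgM.
  have := PM 1%N n _ _ (P1 _ (LV _ Lb)) (IH _ Pa); rewrite add1n; exact.
exists (\bigcup_n P n); split; last by exists P.
- by exists 0%N.
- by move=> x y [m _ Pm] [n _ Pn]; exists (m + n)%N => //; apply: PM => //; exact: PV.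
- rewrite openE => x [n _ Pnx]; rewrite /interior.
  (* The translate [x K] is a neighbourhood of [x] and lies in [P n.+1]. *)
  have : nbhs x ((fun y => (x^-1 * y)%g) @^-1` K).
    by apply: continuous_mulgl; rewrite mulVg.
  apply: filterS => y Ky; exists n.+1 => //; exists (x, x^-1 * y)%g => /=.
    by split => //; left.
  by rewrite mulVKg.
Qed.

(* The trace on open sets of a countably complete ultrafilter of Borel sets. *)
Record countably_prime (T : topologicalType) (U : set (set T)) : Prop := {
  cprimeT : U setT ;
  cprime0 : ~ U set0 ;
  cprimeI : forall A B, open A -> open B -> U A -> U B -> U (A `&` B) ;
  cprime_bigcup : forall X (A : nat -> set T), open X -> (forall n, open (A n)) ->
    U X -> X `<=` \bigcup_n A n -> exists n, U (A n) }.

Lemma cprime_cover (T : topologicalType) (U : set (set T)) (I : Type)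
    (D : set I) (X : set T) (A : I -> set T) :
  countably_prime U -> countable D -> open X -> (forall i, open (A i)) ->
  U X -> X `<=` \bigcup_(i in D) A i -> exists2 i, D i & U (A i).
Proof.
move=> cU cD oX oA UX XA.
(* Enumerating [D] requires an element of [D], which a point of [X] provides; [X] is nonempty
   because [U] omits [set0]. *)
have [[x Xx]|X0] := pselect (X !=set0); last first.
  exfalso; apply: (cprime0 cU); suff <- : X = set0 by [].
  by apply/eqP/negP => /negP/set0P.
have [i0 Di0 _] := XA _ Xx.
have [f] : $|{surjfun [set: nat] >-> D}|.
  have /pfcard_geP[D0|//] := cD.
  by move: Di0; rewrite D0.
have [n UAn] : exists n, U (A (f n)).
  apply: (cprime_bigcup cU oX) UX _ => [n|y /XA[i Di Aiy]]; first exact: oA.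
  by have [n _ fn] := 'surj_f Di; exists n => //=; rewrite fn.
by exists (f n) => //; exact: 'funS_f.
Qed.

(** The preimage is the translate [h A]. Only open [A] are tested, as [countably_prime] speaks of
    open sets. *)
Definition stabilizer (G : topologicalGroupType) (U : set (set G)) : set G :=
  [set h | forall A, open A -> U A -> U ((fun x => (h^-1 * x)%g) @^-1` A)].

(** * Left cosets of an open subgroup *)

Definition is_subgroup (G : groupType) (S : set G) :=
  S 1%g /\ forall x y, S x -> S y -> S (x^-1 * y)%g.

Lemma subgroupV (G : groupType) (S : set G) x :
  is_subgroup S -> S x -> S (x^-1)%g.
Proof. by move=> [S1 SS] Sx; rewrite -[(x^-1)%g]mulg1; exact: SS. Qed.

Lemma subgroupM (G : groupType) (S : set G) x y :
  is_subgroup S -> S x -> S y -> S (x * y)%g.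
Proof.
by move=> gS Sx Sy; rewrite -[x]invgK; apply: gS.2 => //; exact: subgroupV.
Qed.

Lemma lcoset_sym (G : groupType) (S : set G) (x y : G) :
  is_subgroup S -> S (x^-1 * y)%g -> S (y^-1 * x)%g.
Proof. by move=> gS /(subgroupV gS); rewrite invgM invgK. Qed.

Lemma lcoset_trans (G : groupType) (S : set G) (y x z : G) :
  is_subgroup S -> S (x^-1 * y)%g -> S (y^-1 * z)%g -> S (x^-1 * z)%g.
Proof.
by move=> gS xy yz; have := subgroupM gS xy yz; rewrite -mulgA mulVKg.
Qed.

Lemma open_lcoset (G : topologicalGroupType) (S : set G) (y : G) :
  open S -> open [set x | S (y^-1 * x)%g].
Proof.
move=> oS; have /continuousP := @continuous_mulgl _ (y^-1)%g; exact.
Qed.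

(** Along with each point, [A] contains its left coset of [S], which is open. *)
Lemma saturated_open (G : topologicalGroupType) (S A : set G) :
  is_subgroup S -> open S -> (forall x y, A x -> S (x^-1 * y)%g -> A y) -> open A.
Proof.
move=> [S1 _] oS AS; rewrite openE => x Ax; rewrite /interior.
apply: (@filterS _ _ _ [set y | S (x^-1 * y)%g]); first by move=> y; exact: AS.
by apply: open_nbhs_nbhs; split; [exact: open_lcoset|rewrite /= mulVg].
Qed.

Lemma open_conj_preimage (G : topologicalGroupType) (S : set G) (h : G) :
  is_subgroup S -> open S -> open [set x | S (x^-1 * (h * x))%g].
Proof.
move=> gS oS; apply: (saturated_open gS oS) => x y /= Sx xy.
have -> : (y^-1 * (h * y) = (x^-1 * y)^-1 * (x^-1 * (h * x)) * (x^-1 * y))%g.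
  by rewrite invgM invgK -!mulgA !mulVKg.
by do 2!apply: subgroupM => //; exact: subgroupV.
Qed.

(* On the classes of the relation [E], generated by left cosets of [S] and
   translation by [h], choose representatives [r]. A set of points with the same
   exponents relative to [r] is in [U], hence so is its intersection with its
   translate by [h], on which translation by [h] fixes the coset. *)
Lemma stabilizer_conj (G : topologicalGroupType) (U : set (set G)) (S : set G) (h : G) :
  countably_prime U -> is_subgroup S -> open S -> stabilizer U h ->
  U [set x | S (x^-1 * (h * x))%g].
Proof.
move=> cU gS oS Hh.
pose E x y := exists a b, S ((h ^+ a * x)^-1 * (h ^+ b * y))%g.
have Exx x : E x x by exists 0%N, 0%N; rewrite mulVg; exact: gS.1.
have Esym x y : E x y -> E y x.
  by move=> [a [b Eab]]; exists b, a; exact: lcoset_sym.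
have Etrans x y z : E x y -> E y z -> E x z.
  (* Powers of [h] commute: shifting the first relation by [h ^+ c] and the second by [h ^+ b] makes
     their middle terms agree. *)
  move=> [a [b Eab]] [c [d Ecd]]; exists (c + a)%N, (b + d)%N.
  rewrite !expgnDr -!mulgA; apply: (@lcoset_trans _ _ (h ^+ c * (h ^+ b * y))%g) => //.
    by rewrite invgM -mulgA mulKg.
  by rewrite !mulgA -expgnDr addnC expgnDr -!mulgA invgM -mulgA mulKg.
pose r x := xget 1%g [set y | E x y].
have Er x : E x (r x) by apply: (@xgetPex _ 1%g [set y | E x y]); exists x; exact: Exx.
have rE x y : E x y -> r x = r y.
  move=> Exy; rewrite /r; congr xget; apply/seteqP; split=> z /=.
    exact/Etrans/Esym.
  exact: Etrans.
pose A (ab : nat * nat) := [set x | S ((h ^+ ab.1 * x)^-1 * (h ^+ ab.2 * r x))%g].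
have oA ab : open (A ab).
  apply: (saturated_open gS oS) => x y /= Ax xy.
  rewrite /A /= -(rE x y); last by exists 0%N, 0%N; rewrite !mul1g.
  apply: lcoset_trans Ax => //.
  by apply: lcoset_sym => //; rewrite invgM -mulgA mulKg.
have [ab _ UA] : exists2 ab, setT ab & U (A ab).
  apply: (cprime_cover cU (D := setT) (X := setT)) => //; first exact: openT.
    exact: cprimeT.
  by move=> x _; have [a [b]] := Er x; exists (a, b).
have UhA := Hh _ (oA ab) UA.
have ohA : open ((fun x : G => (h^-1 * x)%g) @^-1` A ab) by exact: open_lcoset.
have UAhA := cprimeI cU (oA ab) ohA UA UhA.
(* Applied to a constant family, [cprime_cover] says that [U] is upward closed on open sets. *)
suff: exists2 n, [set: nat] n & U [set x | S (x^-1 * (h * x))%g] by case.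
apply: (cprime_cover (A := fun=> _) cU _ (openI (oA ab) ohA) _ UAhA) => //.
- by move=> _; exact: open_conj_preimage.
- move=> x; rewrite /A /= => -[Ax]; rewrite (rE (h^-1 * x)%g x); last first.
    by exists 1%N, 0%N; rewrite mulVKg mul1g mulVg; exact: gS.1.
  (* With [ab = (a, b)], both [h ^+ a * (h^-1 * x)] and [h ^+ a * x] lie in the left coset of
     [h ^+ b * r x]; cancelling [h ^+ a] gives the claim. *)
  move=> Ahx; exists 0%N => //=.
  have := lcoset_trans gS Ahx (lcoset_sym gS Ax).
  by rewrite !invgM invgK -!mulgA mulKg.
Qed.

Lemma sigma_compact_image (T T' : topologicalType) (f : T -> T') (S : set T) :
  continuous f -> sigma_compact S -> sigma_compact (f @` S).
Proof.
move=> cf [K cK ->]; exists (fun n => f @` K n); last exact: image_bigcup.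
by move=> n; apply: continuous_compact => //; exact: continuous_subspaceT.
Qed.

(* For [U]-most [x] the conjugate [x S x^-1] contains [h], and it meets only
   countably many left cosets of [S]: enumerate these as [c_n x]. By countable
   completeness [h] is in [c_n x S] for [U]-most [x], for some [n], and [n]
   determines the coset [h S]. *)
Lemma stabilizer_countable_lcosets (G : topologicalGroupType) (U : set (set G))
    (S : set G) :
  countably_prime U -> is_subgroup S -> open S -> sigma_compact S ->
  exists2 D : set G, countable D &
    forall h, stabilizer U h -> exists2 d, D d & S (d^-1 * h)%g.
Proof.
move=> cU gS oS scS.
have /choice[C CP] x : exists C : set G, countable C /\
    forall s, S s -> exists2 y, C y & S (y^-1 * (x * (s * x^-1)))%g.
  have cf : continuous (fun s => x * (s * x^-1))%g.
    move=> s; apply: (@continuous_comp _ _ _ (fun s => s * x^-1)%g (fun s => x * s)%g).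
      exact: continuous_mulgr.
    exact: continuous_mulgl.
  have [D cD SD] := sigma_compact_cover (F := fun y => [set z | S (y^-1 * z)%g])
    (sigma_compact_image cf scS) (fun y => open_lcoset y oS)
    (fun y => ltac:(rewrite /= mulVg; exact: gS.1)).
  by exists D; split=> // s Ss; apply: SD; exists s.
have /choice[f fP] x : exists f : G -> nat, {in C x &, injective f}.
  by have [+ _] := CP x; move=> /countable_injP[f finj]; exists f.
pose r x := xget 1%g [set y | S (x^-1 * y)%g].
have Sr x : S (x^-1 * r x)%g.
  apply: (@xgetPex _ 1%g [set y | S (x^-1 * y)%g]).
  by exists x; rewrite /= mulVg; exact: gS.1.
have rE x y : S (x^-1 * y)%g -> r x = r y.
  move=> xy; rewrite /r; congr xget; apply/seteqP; split=> z /=.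
    by apply: lcoset_trans => //; exact: lcoset_sym.
  exact: lcoset_trans.
(* The dependence on [x] is only through the representative [r x] of its left coset, so [E n h] is a
   union of left cosets of [S], hence open. *)
pose E n h := [set x | exists y, [/\ C (r x) y, f (r x) y = n & S (y^-1 * h)%g]].
have oE n h : open (E n h).
  by apply: (saturated_open gS oS) => x y + /rE xy; rewrite /E /= xy.
pose d n := xget 1%g [set h | stabilizer U h /\ U (E n h)].
exists (range d); first by apply: card_image_le.
move=> h Hh.
have oF : open [set x | S (x^-1 * (h * x))%g] by exact: open_conj_preimage.
have [|n UE] := cprime_bigcup cU oF (oE^~ h) (stabilizer_conj cU gS oS Hh).
  move=> x /= Sx; pose q := r x.
  have Sq : S (q^-1 * (h * q))%g.
    have -> : (q^-1 * (h * q) = (x^-1 * q)^-1 * (x^-1 * (h * x)) * (x^-1 * q))%g.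
      by rewrite invgM invgK -!mulgA !mulVKg.
    exact: subgroupM gS (subgroupM gS (subgroupV gS (Sr x)) Sx) (Sr x).
  have [y Cy] := (CP q).2 _ Sq.
  by rewrite -!mulgA mulgV mulg1 mulVKg => Sy; exists (f q y) => //; exists y.
have [Hd UEd] : stabilizer U (d n) /\ U (E n (d n)).
  by apply: (@xgetPex _ 1%g [set h | stabilizer U h /\ U (E n h)]); exists h.
exists (d n); first by exists n.
(* A common point yields a single [y] with number [n], whose left coset contains both [h] and
   [d n]. *)
have [x [[y [Cy fy Sy]] [y' [Cy' fy' Sy']]]] : (E n h `&` E n (d n)) !=set0.
  apply/set0P/negP => /eqP I0; apply: (cprime0 cU).
  by rewrite -I0; apply: cprimeI.
have yy' : y = y' by apply: (fP (r x)); rewrite ?inE // fy.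
by apply: (lcoset_trans gS (lcoset_sym gS Sy')); rewrite -yy'.
Qed.

(** The cosets [d c S] with [d] in [D] and [c] in [C] cover [G], so countably many translates of a
    neighbourhood of 1 do. One of these is in [U], which forces the stabilizer to be trivial; then
    [D] exhausts [G]. *)
Lemma countable_group_of_stabilizer (G : topologicalGroupType) (U : set (set G))
    (D : set G) :
  locally_compact [set: G] -> hausdorff_space G -> countably_prime U ->
  countable D -> (forall g, exists2 d, D d & stabilizer U (d^-1 * g)%g) ->
  countable [set: G].
Proof.
move=> lcG hG cU cD DP.
have [S [S1 SS oS scS]] := open_sigma_compact_subgroup lcG.
have gS : is_subgroup S by [].
have [C cC CP] := stabilizer_countable_lcosets cU gS oS scS.
suff H1 h : stabilizer U h -> h = 1%g.
  apply: sub_countable cD; apply: subset_card_le => g _.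
  by have [d Dd /H1 /eqP] := DP g; rewrite mulg_eq1 eqg_inv => /eqP <-.
move=> Hh; apply: contrapT => h1.
have [[A B] /= [A1 Bh] [oA oB AB]] : exists2 AB : set G * set G,
    1%g \in AB.1 /\ h \in AB.2 & [/\ open AB.1, open AB.2 & AB.1 `&` AB.2 == set0].
  move: hG; rewrite open_hausdorff => /(_ 1%g h) [].
    by apply/eqP => h1'; apply: h1.
  by move=> AB ? ?; exists AB.
move: A1 Bh; rewrite !inE => A1 Bh.
(* [V] is a neighbourhood of 1 disjoint from [h V]. *)
pose V := A `&` (fun x => (h * x)%g) @^-1` B.
have oV : open V.
  by apply: openI => //; have /continuousP := @continuous_mulgl _ h; exact.
pose F x := [set y : G | V (y * x^-1)%g].
have oF x : open (F x).
  by have /continuousP := @continuous_mulgr _ (x^-1)%g; exact.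
have Fxx x : F x x by rewrite /F /= mulgV; split => //=; rewrite mulg1.
have /choice[X XP] g : exists X : set G, countable X /\
    [set y | S (g^-1 * y)%g] `<=` \bigcup_(x in X) F x.
  have := sigma_compact_cover (sigma_compact_image (@continuous_mulgl _ g) scS) oF Fxx.
  move=> [X cX SX]; exists X; split => // y Sy; apply: SX.
  by exists (g^-1 * y)%g => //; rewrite mulVKg.
pose Y := \bigcup_(de in D `*` C) X (de.1 * de.2)%g.
have cY : countable Y.
  apply: bigcup_countable; first exact: countableX.
  by move=> de _; exact: (XP _).1.
have [y Yy UF] : exists2 y, Y y & U (F y).
  apply: (cprime_cover cU cY openT oF (cprimeT cU)) => g _.
  have [d Dd /CP[c Cc Sc]] := DP g.
  have [|x Xx Fx] := (XP (d * c)%g).2 g; first by rewrite /= invgM -mulgA.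
  by exists x => //; exists (d, c).
have ohF : open ((fun x => (h^-1 * x)%g) @^-1` F y).
  by have /continuousP := @continuous_mulgl _ (h^-1)%g; exact.
have UI := cprimeI cU (oF y) ohF UF (Hh _ (oF y) UF).
apply: (cprime0 cU); rewrite (_ : set0 = F y `&` (fun x => (h^-1 * x)%g) @^-1` F y) //.
apply/esym/seteqP; split => // z [[Az _] [_ /=]].
rewrite -mulgA mulVKg => Bz.
by move/eqP/seteqP: AB => [+ _]; apply; split; first exact: Az.
Qed.

(** * Atoms of measures *)

Section Atoms.
Context d (T : measurableType d) (R : realType) (mu : {measure set T -> \bar R}).
Local Open Scope ereal_scope.

Definition measure_atom (B : set T) :=
  [/\ measurable B, 0 < mu B, mu B < +oo & forall C, measurable C ->
      mu (B `&` C) = 0 \/ mu (B `\` C) = 0].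

(* [measureDI] and [measureU] are stated for contents; stated for measures, they
   leave terms on which hypotheses about [mu] can be used for rewriting. *)
Lemma measure_setDI A B : measurable A -> measurable B ->
  mu A = mu (A `\` B) + mu (A `&` B).
Proof. exact: measureDI. Qed.

Let measureU A B : measurable A -> measurable B -> A `&` B = set0 ->
  mu (A `|` B) = mu A + mu B.
Proof. exact: measureU. Qed.

(** Otherwise [B] would be a countable union of null sets. *)
Lemma measure_cover_gt0 (A : nat -> set T) (B : set T) :
  measurable B -> (forall n, measurable (A n)) -> 0 < mu B ->
  B `<=` \bigcup_n A n -> exists n, 0 < mu (B `&` A n).
Proof.
move=> mB mA B0 BA; apply: contrapT => /forallNP H.
move: B0; rewrite lt_neqAle => /andP[/eqP + _]; apply; apply/esym.
apply/(negligibleP mu mB).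
apply: (@negligibleS _ _ _ _ (\bigcup_n (B `&` A n))).
  by rewrite -setI_bigcupr => x Bx; split => //; exact: BA.
apply: negligible_bigcup => n; apply/negligibleP; first exact: measurableI.
by apply/eqP; have := H n; rewrite measure_gt0 => /negP; rewrite negbK.
Qed.

(** A set of finite measure cannot contain infinitely many almost disjoint pieces of mass [m].
    Applied to the translates of one atom, this gives the countable index of the stabilizer. *)
Lemma countable_atoms (I : eqType) (A : I -> set T) (m : \bar R) :
  sigma_finite [set: T] mu -> (forall i, measure_atom (A i)) ->
  0 < m -> (forall i, mu (A i) = m) ->
  exists2 D : set I, countable D &
    forall i, exists2 j, D j & mu (A j `\` A i) = 0.
Proof.
move=> [F FT FP] atA m0 Am.
have mA i : measurable (A i) by case: (atA i).
have mF n : measurable (F n) by have [] := FP n.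
suff /choice[D DP] n : exists D : set I, countable D /\
    forall i, 0 < mu (A i `&` F n) -> exists2 j, D j & mu (A j `\` A i) = 0.
  exists (\bigcup_n D n).
    by apply: bigcup_countable => // n _; case: (DP n).
  move=> i; have [n] : exists n, 0 < mu (A i `&` F n).
    by apply: measure_cover_gt0; rewrite ?Am // -FT.
  by move=> /(DP n).2[j Dj ji]; exists j => //; exists n.
apply: contrapT => /forallNP noD.
have AF i : 0 < mu (A i `&` F n) -> mu (A i `&` F n) = m.
  move=> pos; case: (atA i) => _ _ _ /(_ (F n) (mF n))[AF0|AF0].
    by move: pos; rewrite AF0 ltxx.
  by rewrite -(Am i) (measure_setDI (mA i) (mF n)) AF0 add0e.
(* If no [D] serves [F n], every finite list of atoms leaves out one almost disjoint from all of
   them, whose trace on [F n] adds [m] to the measure. *)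
have fill N : exists l : seq I,
    N%:R%:E * m <= mu (\big[setU/set0]_(i <- l) (A i `&` F n)).
  elim: N => [|N [l lN]]; first by exists [::]; rewrite mul0e.
  set W := \big[setU/set0]_(i <- l) (A i `&` F n) in lN.
  have mW : measurable W by apply: bigsetU_measurable => i _; exact: measurableI.
  have /not_andP[[]|/existsNP[i /not_implyP[iF]]] := noD [set` l].
    exact/finite_set_countable/finite_seq.
  move=> Hi; exists (i :: l); rewrite big_cons -/W.
  have iW : mu (A i `&` F n `&` W) = 0.
    apply: measure_negligible; first by apply: measurableI => //; exact: measurableI.
    have {}Hi j : j \in l -> mu (A j `&` A i) = 0.
      move=> lj; case: (atA j) => _ _ _ /(_ _ (mA i))[//|ji].
      by exfalso; apply: Hi; exists j.
    rewrite /W; elim: (l) Hi => [|j l' IH] Hi.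
      by rewrite big_nil setI0; exact: negligible_set0.
    rewrite big_cons setIUr; apply: negligibleU; last first.
      by apply: IH => k kl; apply: Hi; rewrite inE kl orbT.
    apply: (@negligibleS _ _ _ _ (A j `&` A i)); first by move=> x [[? _] []].
    by apply/negligibleP; [exact: measurableI|apply: Hi; rewrite inE eqxx].
  have mi : measurable (A i `&` F n) by exact: measurableI.
  have iWE : mu ((A i `&` F n) `\` W) = m.
    by have := measure_setDI mi mW; rewrite AF // iW adde0.
  rewrite setUC -[W `|` _]setD0 -(setDv W) -setUDr measureU //; last 2 first.
  - exact: measurableD.
  - exact: setDIK.
  by rewrite -natr1 EFinD ge0_muleDl ?lee_fin ?ler0n ?ler01 // mul1e leeD // iWE.
have leF k : k%:R%:E * m <= mu (F n).
  have [l lk] := fill k; apply: le_trans lk _.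
  apply: le_measure; rewrite ?inE //.
    by apply: bigsetU_measurable => i _; exact: measurableI.
  elim: l => [|i l IH]; first by rewrite big_nil.
  by rewrite big_cons subUset.
have [_ Fn] := FP n.
have fF : mu (F n) \is a fin_num by rewrite ge0_fin_numE.
have fm : m \is a fin_num.
  rewrite ge0_fin_numE ?ltW //; apply: le_lt_trans Fn.
  by rewrite -[m]mul1e; exact: (leF 1%N).
have m0' : (0 < fine m)%R by rewrite fine_gt0 // m0 -ge0_fin_numE // ltW.
have := leF (Num.truncn (fine (mu (F n)) / fine m)).+1.
rewrite -(fineK fm) -(fineK fF) -EFinM lee_fin -ler_pdivlMr // leNgt.
by rewrite truncnS_gt.
Qed.
End Atoms.

(** * Invariant Borel measures with an atom *)

Lemma open_borel (G : topologicalGroupType) (A : set G) :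
  open A -> measurable (A : set (borelType G)).
Proof. exact: sub_gen_smallest. Qed.

Lemma borel_continuous (G : topologicalGroupType) (f : G -> G) :
  continuous f -> measurable_fun [set: borelType G] (f : borelType G -> borelType G).
Proof.
move=> /continuousP cf _ A mA; rewrite setTI.
suff: <<s @open G >> `<=` [set B | measurable (f @^-1` B : set (borelType G))].
  by apply.
apply: smallest_sub => [|B oB]; last by apply: open_borel; exact: cf.
split => [|B mB|B mB] /=.
- by rewrite preimage_set0; exact: measurable0.
- by rewrite setTD preimage_setC; exact: measurableC.
- by rewrite preimage_bigcup; exact: bigcupT_measurable.
Qed.

Lemma borel_preimage (G : topologicalGroupType) (f : G -> G) (A : set (borelType G)) :
  continuous f -> measurable A -> measurable (f @^-1` A : set (borelType G)).
Proof.
by move=> /borel_continuous cf mA; rewrite -[X in measurable X]setTI; exact: cf.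
Qed.

Section LeftInvariant.
Context (R : realType) (G : topologicalGroupType).
Context (mu : {measure set (borelType G) -> \bar R}).
Context (mu_left : left_invariant mu).
Local Open Scope ereal_scope.

(** The translate [g A], written as a preimage so that it commutes with set operations by
    conversion. *)
Let tr (g : G) (A : set (borelType G)) : set (borelType G) :=
  (fun x : G => (g^-1 * x)%g) @^-1` A.

Let measurable_tr g A : measurable A -> measurable (tr g A).
Proof. by apply: borel_preimage; exact: continuous_mulgl. Qed.

Let mu_tr g A : measurable A -> mu (tr g A) = mu A.
Proof. by move=> mA; rewrite /tr -image_mulgl; exact: mu_left. Qed.

Let trK g A : tr g (tr g^-1%g A) = A.
Proof. by apply/funext => x; rewrite /tr /= invgK mulVKg. Qed.

Let atom_tr g B : measure_atom mu B -> measure_atom mu (tr g B).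
Proof.
move=> [mB B0 By atB]; split; rewrite ?mu_tr //; first exact: measurable_tr.
move=> C mC; have mgC := measurable_tr g^-1%g mC.
rewrite -[C](trK g) -[tr g B `&` _]/(tr g (B `&` _)) -[tr g B `\` _]/(tr g (B `\` _)).
by rewrite !mu_tr; [exact: atB|exact: measurableD|exact: measurableI].
Qed.

(** When the [A n] cover [X], one of them meets [B] in positive measure; as [B] is an atom, the part
    of [B] outside it is null. *)
Let atom_countably_prime B : measure_atom mu B ->
  countably_prime [set A : set G | mu (B `\` A) = 0].
Proof.
move=> [mB B0 By atB]; split => /=.
- by rewrite setDT measure0.
- by rewrite setD0 => B00; move: B0; rewrite B00 ltxx.
- move=> A C /open_borel mA /open_borel mC BA BC; rewrite setDIr.
  apply: measure_negligible; first by apply: measurableU; exact: measurableD.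
  by apply: negligibleU; apply/negligibleP => //; exact: measurableD.
- move=> X A oX oA BX XA; have mX := open_borel oX.
  have mA n := open_borel (oA n).
  have BX0 : 0 < mu (B `&` X).
    by have := measure_setDI mu mB mX; rewrite BX add0e => <-.
  have [|n /=] := measure_cover_gt0 (measurableI _ _ mB mX) mA BX0 _.
    by move=> x [_ /XA].
  move=> pos; exists n; have [BA|//] := atB _ (mA n).
  move: pos; suff -> : mu (B `&` X `&` A n) = 0 by rewrite ltxx.
  apply: subset_measure0 BA; [|exact: measurableI|].
    by apply: measurableI; first exact: measurableI.
  by move=> x [[]].
Qed.

(** A point of [B] outside [h A] is either outside [h B] or in the translate by [h] of the part of
    [B] outside [A]; both sets are null. *)
Let atom_stabilizer B h : measure_atom mu B -> mu (B `\` tr h B) = 0 ->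
  stabilizer [set A : set G | mu (B `\` A) = 0] h.
Proof.
move=> [mB _ _ _] BhB A /open_borel mA /= BA.
rewrite -[(fun _ => _) @^-1` A]/(tr h A).
have mhA g C : measurable C -> measurable (B `\` tr g C).
  by move=> mC; apply: measurableD => //; exact: measurable_tr.
apply: measure_negligible; first exact: mhA.
apply: (@negligibleS _ _ _ _ ((B `\` tr h B) `|` tr h (B `\` A))).
  move=> x [Bx nA]; have [hB|nhB] := pselect (tr h B x); last by left.
  by right; split.
apply: negligibleU; apply/negligibleP => //; first exact: mhA.
  by apply: measurable_tr; exact: measurableD.
by apply: etrans (mu_tr h _) BA; exact: measurableD.
Qed.

Lemma left_invariant_atom_countable B :
  locally_compact [set: G] -> hausdorff_space G ->
  sigma_finite [set: borelType G] mu -> measure_atom mu B -> countable [set: G].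
Proof.
move=> lcG hG sf atB; have [mB B0 _ _] := atB.
have [D cD DP] := countable_atoms (A := tr^~ B) sf (fun g => atom_tr g atB) B0
  (fun g => mu_tr g mB).
apply: (countable_group_of_stabilizer lcG hG (atom_countably_prime atB) cD) => g.
have [d Dd dg] := DP g; exists d => //.
apply: atom_stabilizer => //.
(* Translation by [d] carries this set to the difference of [d B] and [g B], null by the choice of
   [d]. *)
rewrite -(@mu_tr d); last by apply: measurableD => //; exact: measurable_tr.
rewrite -[RHS]dg; congr (mu (_ `\` _)); apply/funext => x.
by rewrite /tr /= invgM invgK -mulgA mulVKg.
Qed.

End LeftInvariant.

Lemma closed_singleton_borel (G : topologicalGroupType) (x : G) :
  hausdorff_space G -> measurable ([set x] : set (borelType G)).
Proof.
move=> hG; rewrite -[X in measurable X]setCK; apply: measurableC.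
apply: open_borel; apply: closed_openC.
exact/accessible_closed_set1/hausdorff_accessible.
Qed.

(** Inversion exchanges left and right invariance, which reduces the right-invariant case to the
    left-invariant one. *)
Lemma inverse_measure (R : realType) (G : topologicalGroupType)
    (mu : {measure set (borelType G) -> \bar R}) :
  exists nu : {measure set (borelType G) -> \bar R},
    forall A : set (borelType G), nu A = mu ((fun x : G => x^-1%g) @^-1` A).
Proof.
unshelve refine (ex_intro _ (pushforward mu
  (fun x : borelType G => (x : G)^-1%g : borelType G) : {measure set _ -> \bar R}) _).
  by apply: borel_continuous; exact: invg_continuous.
by [].
Qed.

Lemma invariant_atom_countable (R : realType) (G : topologicalGroupType)
    (mu : {measure set (borelType G) -> \bar R}) (B : set (borelType G)) :
  locally_compact [set: G] -> hausdorff_space G ->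
  left_invariant mu \/ right_invariant mu ->
  sigma_finite [set: borelType G] mu -> measure_atom mu B -> countable [set: G].
Proof.
move=> lcG hG [linv|rinv] sf atB.
  exact: left_invariant_atom_countable atB.
have [nu nuE] := inverse_measure mu.
pose inv := fun x : G => (x^-1)%g.
have invK (A : set (borelType G)) : inv @^-1` (inv @^-1` A) = A.
  by apply/funext => x; rewrite /inv /= invgK.
have mi (A : set (borelType G)) : measurable A ->
    measurable (inv @^-1` A : set (borelType G)).
  by apply: borel_preimage; exact: invg_continuous.
apply: (@left_invariant_atom_countable _ _ nu _ (inv @^-1` B)) => //.
- move=> g A mA; rewrite !nuE -/inv -(rinv g^-1%g _ (mi _ mA)).
  congr (mu _); apply/seteqP; split => x /=.
    move=> [a Aa ax]; exists (inv a); first by rewrite /inv /= invgK.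
    by rewrite /inv -invgM ax /inv invgK.
  move=> [y Ay <-]; exists (inv y) => //.
  by rewrite /inv /= invgM invgK.
- case: sf => F FT FP; exists (fun n => inv @^-1` (F n)).
    by rewrite -preimage_bigcup -FT preimage_setT.
  by move=> n; have [mF Fy] := FP n; split; [exact: mi|rewrite nuE invK].
- have [mB B0 By atBC] := atB; split; rewrite ?nuE ?invK //; first exact: mi.
  move=> C mC; rewrite !nuE setDE !preimage_setI preimage_setC !invK -setDE.
  by apply: atBC; exact: mi.
Qed.

(** In a countable group the atom contains a point of positive finite mass, and invariance gives
    every point that mass. *)
Lemma invariant_atom_counting (R : realType) (G : topologicalGroupType)
    (mu : {measure set (borelType G) -> \bar R}) (B : set (borelType G)) :
  hausdorff_space G -> left_invariant mu \/ right_invariant mu ->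
  countable [set: G] -> measure_atom mu B ->
  exists2 c : R, 0 < c & forall A : set (borelType G), measurable A ->
    mu A = (c%:E * counting A)%E.
Proof.
move=> hG inv cG [mB B0 By _].
have m1 (x : G) : measurable ([set x] : set (borelType G)).
  exact: closed_singleton_borel.
have [b b0] : exists b : G, (0 < mu (B `&` [set b]))%E.
  have [f] : $|{surjfun [set: nat] >-> [set: G]}|.
    have /pfcard_geP[D0|//] := cG.
    by have : [set: G] 1%g by []; rewrite D0.
  have [|n] := measure_cover_gt0
    (A := fun n => [set f n] : set (borelType G)) mB (fun n => m1 (f n)) B0.
    by move=> x _; have [n _ <-] := 'surj_f (I : [set: G] x); exists n.
  by exists (f n).
have Bb : mu (B `&` [set b]) = mu [set b].
  have [Bb|nBb] := pselect (B b).
    by congr (mu _); apply/seteqP; split => [x []|x ->].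
  move: b0; rewrite (_ : B `&` [set b] = set0) ?measure0 ?ltxx //.
  by apply/seteqP; split => // x [Bx xb]; apply: nBb; rewrite -xb.
have by_ : (mu [set b] < +oo)%E.
  rewrite -Bb; apply: le_lt_trans By; apply: le_measure; rewrite ?inE //.
  exact: measurableI.
rewrite Bb in b0.
have bE x : mu [set x] = mu [set b].
  case: inv => inv.
    rewrite -(inv (x * b^-1)%g _ (m1 b)) image_set1; congr (mu [set _]).
    by rewrite mulgVK.
  rewrite -(inv (b^-1 * x)%g _ (m1 b)) image_set1; congr (mu [set _]).
  by rewrite mulVKg.
exists (fine (mu [set b])); first by rewrite fine_gt0 // b0.
move=> A mA.
have fb : mu [set b] \is a fin_num by rewrite ge0_fin_numE.
rewrite fineK //.
have finE (X : {fset borelType G}) :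
    mu [set` X] = (mu [set b] * (#|` X|)%:R%:E)%E.
  have -> : [set` X] = \big[setU/set0]_(x <- X) [set x].
    by rewrite -bigcup_fset bigcup_imset1 image_id.
  rewrite measure_fbigsetU //; last first.
    by move=> x y _ _ [z [/= -> ->]].
  rewrite (eq_bigr (fun=> (fine (mu [set b]))%:E)) => [|x _]; last first.
    by rewrite fineK //; exact: bE.
  rewrite sumEFin big_const_seq count_predT iter_addr addr0.
  by rewrite -[X in X%:E]mulr_natr EFinM fineK.
rewrite /counting; case: asboolP => [fA|iA].
  by rewrite -{1}(fset_setK fA) finE.
rewrite gt0_muley //.
(* If [mu A] were finite, a finite subset with more than [mu A / mu [set b]] points would have
   larger measure than [A]. *)
apply/eqP; rewrite -leye_eq leNgt; apply/negP => Ay.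
have fA : mu A \is a fin_num by rewrite ge0_fin_numE.
have [X XA cX] := infinite_set_fset (Num.truncn (fine (mu A) / fine (mu [set b]))).+1 iA.
have : (mu [set` X] <= mu A)%E.
  apply: le_measure; rewrite ?inE //.
  have -> : [set` X] = \big[setU/set0]_(x <- X) [set x].
    by rewrite -bigcup_fset bigcup_imset1 image_id.
  by apply: bigsetU_measurable.
rewrite finE -(fineK fA) -(fineK fb) -EFinM lee_fin leNgt => /negP; apply.
rewrite mulrC -ltr_pdivrMr; last by rewrite fine_gt0 // b0.
apply: lt_le_trans (truncnS_gt _) _.
by rewrite ler_nat.
Qed.

(** * Compact multiplication operators *)

(** The sequence has a cluster point; two terms with distinct indices within [e / 2] of it
    contradict the separation. *)
Lemma precompact_not_separated (K : numFieldType) (V : normedModType K) (A : set V)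
    (u : nat -> V) (e : K) :
  0 < e -> precompact A -> (forall n, A (u n)) ->
  ~ (forall m n, (m < n)%N -> e <= `|u m - u n|).
Proof.
move=> e0 [B AB [cB _]] Au sep.
have e20 : 0 < e / 2 by rewrite divr_gt0.
have [|z [_ zu]] := cB (u @ \oo) _; first by exists 0%N => // n _; exact/AB/Au.
have zb : nbhs z (ball z (e / 2)) by exact: nbhsx_ballx.
have near_z N : exists2 n, (N <= n)%N & ball z (e / 2) (u n).
  have [|x [[n /= Nn <-] zn]] := zu [set u n | n in [set n | (N <= n)%N]] _ _ zb.
    by exists N => // n Nn; exists n.
  by exists n.
have [m _ zm] := near_z 0%N; have [n mn zn] := near_z m.+1.
have := ball_splitr zm zn; rewrite -ball_normE /= => mne.
by have := lt_le_trans mne (sep m n mn); rewrite ltxx.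
Qed.

Section AtomicOfCompact.
Context d (T : measurableType d) (R : realType) (mu : {measure set T -> \bar R}).
Local Open Scope ereal_scope.
Local Open Scope quotient_scope.

(** A set that is not an atom splits into two parts of positive measure: one is split further, the
    other becomes [E n]. *)
Lemma nonatomic_disjoint_sequence (A : set T) :
  measurable A -> 0 < mu A -> mu A < +oo -> (forall B, ~ measure_atom mu B) ->
  exists2 E : nat -> set T,
    forall n, [/\ measurable (E n), E n `<=` A, 0 < mu (E n) & mu (E n) < +oo] &
    forall m n, (m < n)%N -> E m `&` E n = set0.
Proof.
move=> mA A0 Ay noatom.
have /choice[D DP] (C : set T) : exists D, measurable C -> 0 < mu C -> mu C < +oo ->
    [/\ measurable D, 0 < mu (C `&` D) & 0 < mu (C `\` D)].
  have [CP|nCP] := pselect [/\ measurable C, 0 < mu C & mu C < +oo]; last first.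
    by exists set0 => *; exfalso; apply: nCP.
  have [mC C0 Cy] := CP.
  have : ~ forall D, measurable D -> mu (C `&` D) = 0 \/ mu (C `\` D) = 0.
    by move=> H; apply: (noatom C); split.
  move=> /existsNP[D /not_implyP[mD /not_orP[D1 D2]]]; exists D => _ _ _.
  by split => //; rewrite measure_gt0; exact/eqP.
pose C n := iter n (fun C => C `&` D C) A.
have CP n : [/\ measurable (C n), C n `<=` A, 0 < mu (C n) & mu (C n) < +oo].
  elim: n => [|n [mC CA C0 Cy]] /=; first by split.
  have [mD D0 _] := DP (C n) mC C0 Cy.
  split => //; first exact: measurableI.
    by move=> x [/CA].
  apply: le_lt_trans Cy; apply: le_measure; rewrite ?inE //; exact: measurableI.
have Cdecr m n : (m <= n)%N -> C n `<=` C m.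
  by move=> /subnK <-; elim: (n - m)%N => // k IH x [/IH].
exists (fun n => C n `\` C n.+1) => [n|m n mn]; last first.
  by apply/seteqP; split => // x [[_ nC] [Cn _]]; apply: nC; exact: Cdecr Cn.
have [mC CA C0 Cy] := CP n; have [mC' _ _ _] := CP n.+1.
have mE : measurable (C n `\` C n.+1) by exact: measurableD.
split => //; first by move=> x [/CA].
  have [_ _] := DP _ mC C0 Cy.
  by rewrite /= setDIr setDv set0U.
by apply: le_lt_trans Cy; apply: le_measure; rewrite ?inE //; exact: subDsetl.
Qed.

Definition cindic (A : set T) (x : T) : R[i] := ((\1_A x)%:C)%C.

Lemma cmeasurable_cindic A : measurable A -> cmeasurable (cindic A).
Proof.
move=> mA; split; last exact: measurable_cst.
by apply: measurable_indic.
Qed.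

Lemma normc_cindic A x : ComplexField.Normc.normc (cindic A x) = \1_A x :> R.
Proof. by rewrite /= expr0n addr0 sqrtr_sqr ger0_norm. Qed.

Lemma cLnorm2_cindic A : measurable A ->
  cLnorm mu 2%:E (cindic A) = mu A `^ 2^-1.
Proof.
move=> mA.
have -> : mu A = cLnorm mu 2%:E (cindic A) `^ 2.
  rewrite /cLnorm poweR_Lnorm //.
  rewrite -[in LHS](setIT A) -integral_indic //; apply: eq_integral => x _.
  rewrite [(EFin \o _) x](_ : _ = (\1_A x)%:E); last by rewrite -normc_cindic.
  rewrite /= indicE; case: (x \in A) => /=.
    by rewrite normr1 powR1.
  by rewrite normr0 powR0.
by rewrite -poweRrM mulfV // poweRe1 // Lnorm_ge0.
Qed.

Lemma cindic_L2 A : measurable A -> mu A < +oo ->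
  cindic A \in cLfun mu (lee1n 2).
Proof.
move=> mA Ay; apply/cLfunP; split; first exact: cmeasurable_cindic.
by rewrite cLnorm2_cindic // poweR_lty.
Qed.

(** The sets where the modulus is at least [1 / (n + 1)] cover the set where [f] is nonzero, so one
    has positive measure; sigma-finiteness cuts it down to finite measure. *)
Lemma Linfty_neq0_bounded_below (f : Linfty mu) :
  sigma_finite [set: T] mu -> f <> 0%R ->
  exists A : set T, exists2 e : R, (0 < e)%R &
    [/\ measurable A, 0 < mu A, mu A < +oo &
      forall x, A x ->
        (e <= ComplexField.Normc.normc ((repr f : cLfunType mu (leey 1)) x))%R].
Proof.
move=> [F FT FP] f0; set g : cLfunType mu (leey 1) := repr f.
have ng : measurable_fun [set: T] (fun x => ComplexField.Normc.normc (g x)).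
  exact/cmeasurable_normc/cLmeas.
pose A (n : nat) := [set x | (n.+1%:R^-1 <= ComplexField.Normc.normc (g x))%R].
have mA n : measurable (A n).
  have := measurable_fun_le measurableT (measurable_cst (n.+1%:R^-1 : R)%R) ng.
  by rewrite setTI.
have [n An] : exists n, 0 < mu (A n).
  apply: contrapT => /forallNP An; apply: f0.
  rewrite -[f]reprK (_ : 0%R = \pi_(Linfty mu) (0%R : cLfunType mu (leey 1)));
    last by rewrite piE.
  apply/cLspaceP; rewrite -/g.
  apply: (@negligibleS _ _ _ _ (\bigcup_n A n)); last first.
    apply: negligible_bigcup => n; apply/negligibleP => //.
    by apply/eqP; have := An n; rewrite measure_gt0 => /negP; rewrite negbK.
  move=> x /= gx; have gx0 : (0 < ComplexField.Normc.normc (g x))%R.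
    rewrite lt_neqAle normc_ge0 andbT eq_sym; apply/eqP => /ComplexField.Normc.eq0_normc.
    exact: gx.
  exists (Num.truncn (ComplexField.Normc.normc (g x))^-1%R) => //=.
  rewrite /A /= -[leRHS]invrK lef_pV2 ?posrE ?invr_gt0 //.
  by apply: ltW; exact: truncnS_gt.
have [|k Fk] := measure_cover_gt0 (mA n) (fun k => (FP k).1) An.
  by rewrite -FT.
exists (A n `&` F k), n.+1%:R^-1%R; first by rewrite invr_gt0.
split => //.
- by apply: measurableI => //; case: (FP k).
- apply: le_lt_trans (FP k).2; apply: le_measure; rewrite ?inE //.
    by apply: measurableI => //; case: (FP k).
  by case: (FP k).
- by move=> x [].
Qed.

End AtomicOfCompact.

Section CompactMultiplication.
Context d (T : measurableType d) (R : realType) (mu : {measure set T -> \bar R}).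
Local Open Scope quotient_scope.

Lemma normc_real (a : R) : 0 <= a -> `|(a%:C)%C| = (a%:C)%C.
Proof. by move=> a0; rewrite normc_def /= expr0n addr0 sqrtr_sqr ger0_norm. Qed.

Lemma compact_mulL_atom (f : Linfty mu) :
  sigma_finite [set: T] mu -> f <> 0 -> compact_op (mulLop mu f) ->
  exists B, measure_atom mu B.
Proof.
move=> sf f0 cptf; apply: contrapT => /forallNP noatom.
have [A [e e0 [mA A0 Ay fA]]] := Linfty_neq0_bounded_below sf f0.
have [E EP Edisj] := nonatomic_disjoint_sequence mA A0 Ay noatom.
have mE n : measurable (E n) by case: (EP n).
have Ey n : (mu (E n) < +oo)%E by case: (EP n).
pose I n : cLfunType mu (lee1n 2) := CLfun (cindic_L2 (mE n) (Ey n)).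
pose k n := (fine (mu (E n) `^ 2^-1)%E)^-1.
have k0 n : 0 <= k n by rewrite invr_ge0 fine_ge0 // poweR_ge0.
pose g n := (k n)%:C%C *: I n.
pose u n : L2space mu := \pi_(L2space mu) (g n).
have u1 n : `|u n| = 1.
  have -> : u n = (k n)%:C%C *: (\pi_(L2space mu) (I n) : L2space mu).
    by rewrite cLspaceZE.
  rewrite normrZ [X in _ * X](cLspace_normE (I n)) cLnorm2_cindic //.
  rewrite normc_real // -rmorphM mulVf //.
  have [_ _ E0 _] := EP n.
  rewrite gt_eqF // fine_gt0 // poweR_gt0 //= poweR_lty //.
apply: (@precompact_not_separated _ (L2space mu) _
  (fun n => mulLop mu f (u n)) (e%:C)%C _ cptf).
- by rewrite ltcR.
- by move=> n; exists (u n) => //=; rewrite u1.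
move=> m n mn.
rewrite -[leLHS]mulr1 -(u1 m) -(normc_real (ltW e0)) -normrZ.
pose h : cLfunType mu (lee1n 2) := mulLfun (repr f) (g m) - mulLfun (repr f) (g n).
have -> : mulLop mu f (u m) - mulLop mu f (u n) = \pi_(L2space mu) h.
  by rewrite /= -[f]reprK !mulLE /h !piE.
have -> : (e%:C)%C *: u m = \pi_(L2space mu) ((e%:C)%C *: g m) by rewrite cLspaceZE.
rewrite [leLHS]cLspace_normE [leRHS]cLspace_normE lecR.
apply: fine_le; rewrite ?cLfin_num //.
(* The comparison is pointwise: on [E m] the term for [n] vanishes and the modulus of [f] is at
   least [e]; off [E m] the left side is 0. *)
apply: (ae_le_cLnorm (lee1n 2)); [exact: cLmeas|exact: cLmeas|].
apply/nearW => x.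
pose F : T -> R[i] := (repr f : cLfunType mu (leey 1)).
suff : ComplexField.Normc.normc ((e%:C)%C * ((k m)%:C%C * cindic R (E m) x)) <=
   ComplexField.Normc.normc (F x * ((k m)%:C%C * cindic R (E m) x) -
     F x * ((k n)%:C%C * cindic R (E n) x)) by [].
rewrite /cindic !indicE.
have [xm|xm] := pselect (E m x); last first.
  by rewrite (memNset xm) !mulr0 ComplexField.Normc.normc0 normc_ge0.
have xn : ~ E n x by move=> xn; have : (E m `&` E n) x by []; rewrite Edisj.
rewrite (memNset xn) (mem_set xm) !mulr0 subr0 mulr1 !ComplexField.Normc.normcM.
apply: ler_wpM2r; first exact: normc_ge0.
rewrite [leLHS](_ : _ = e); last by rewrite /= expr0n addr0 sqrtr_sqr gtr0_norm.
by apply: fA; have [_ EA _ _] := EP m; exact: EA.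
Qed.

End CompactMultiplication.

(** * Rank-one projections *)

Section RankOne.
Context (R : realType) (H : innerProductType R).
Implicit Types (P : boundedOp H) (v x : H).

Lemma ge0_complex_real (z : R[i]) : 0 <= z -> exists2 t : R, 0 <= t & z = (t%:C)%C.
Proof. by case: z => a b; rewrite lecE /= => /andP[/eqP -> a0]; exists a. Qed.

Lemma continuous_scale_real v : continuous (fun a : R => (a%:C)%C *: v).
Proof.
move=> a; apply/cvg_ballP => e e0.
have [eps eps0 eE] := ge0_complex_real (ltW e0).
have [t t0 vE] := ge0_complex_real (normr_ge0 v).
(* The summand 1 keeps the denominator positive when [v] is 0. *)
have d0 : 0 < eps / (t + 1).
  apply: divr_gt0; first by move: e0; rewrite eE ltcR.
  by rewrite ltr_wpDl.
have : nbhs a (ball a (eps / (t + 1))) by exact: nbhsx_ballx.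
apply: filterS => b; rewrite -!ball_normE /= => ab.
rewrite -scalerBl -rmorphB normrZ vE eE normc_def /= expr0n addr0 sqrtr_sqr.
rewrite -rmorphM ltcR; apply: le_lt_trans (_ : `|a - b| * (t + 1) < _).
  by rewrite ler_wpM2l // lerDl.
by rewrite -ltr_pdivlMr // ltr_wpDl.
Qed.

(** The disc of coefficients lies in a square, whose image under a continuous real-linear map is
    compact. *)
Lemma compact_line v (r : R) :
  exists2 K : set H, compact K &
    forall a : R[i], ComplexField.Normc.normc a <= r -> K (a *: v).
Proof.
exists ((fun ab : R * R => (ab.1%:C)%C *: v + (ab.2%:C)%C *: ('i%C *: v)) @`
  (`[- r, r] `*` `[- r, r])).
  apply: continuous_compact; last by apply: compact_setX; exact: segment_compact.
  apply: continuous_subspaceT => -[a b]; apply: cvgD.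
    apply: (@continuous_comp _ _ _ fst (fun a : R => (a%:C)%C *: v)).
      exact: cvg_fst.
    exact: continuous_scale_real.
  apply: (@continuous_comp _ _ _ snd (fun a : R => (a%:C)%C *: ('i%C *: v))).
    exact: cvg_snd.
  exact: continuous_scale_real.
move=> [a b] /= abr; exists (a, b) => /=.
  split; rewrite /= in_itv /= -ler_norml; apply: le_trans abr.
    by rewrite -sqrtr_sqr ler_sqrt ?lerDl ?sqr_ge0 // addr_ge0 ?sqr_ge0.
  by rewrite -sqrtr_sqr ler_sqrt ?lerDr ?sqr_ge0 // addr_ge0 ?sqr_ge0.
rewrite scalerA -scalerDl; congr (_ *: _).
by apply/eqP; rewrite eq_complex /=; apply/andP; split; apply/eqP; ring.
Qed.

Lemma bop0 P : P 0 = 0.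
Proof. by have := bop_linear P (-1) 0 0; rewrite scaler0 addr0 scaleN1r addNr. Qed.

Lemma bopZ P a x : P (a *: x) = a *: P x.
Proof. by have := bop_linear P a x 0; rewrite !addr0 bop0 addr0. Qed.

Lemma compact_rank1 P v :
  (forall x, exists a, P x = a *: v) -> compact_op P.
Proof.
move=> Pv; have [M PM] := bop_bounded P.
have [v0|v0] := eqVneq v 0.
  apply: (@precompact_subset _ _ [set 0]).
    by move=> _ [x _ <-]; have [a ->] := Pv x; rewrite v0 scaler0.
  rewrite precompact_closed; first exact: compact_set1.
  by apply: compact_closed; [exact: norm_hausdorff|exact: compact_set1].
have [t t0 vE] := ge0_complex_real (normr_ge0 v).
have {}t0 : 0 < t by rewrite -ltcR -vE normr_gt0.
(* For [x] in the unit ball, [P x = a *: v] gives [|a| * t <= M]; the maximum with 0 is taken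
   because the sign of [M] is not known. *)
have [K cK KP] := compact_line v (Num.max M 0 / t).
apply: (@precompact_subset _ _ K); last first.
  by rewrite precompact_closed //; apply: compact_closed => //; exact: norm_hausdorff.
move=> _ [x x1 <-]; have [a Pa] := Pv x; rewrite Pa; apply: KP.
rewrite ler_pdivlMr // -lecR rmorphM /= -vE.
rewrite -[(ComplexField.Normc.normc a)%:C%C]/`|a| -normrZ -Pa.
apply: le_trans (PM x) _; apply: le_trans (_ : ((Num.max M 0)%:C)%C * `|x| <= _).
  by rewrite ler_wpM2r // lecR le_max lexx.
by rewrite -[leRHS]mulr1 ler_wpM2l // lecR le_max lexx orbT.
Qed.

Lemma has_dim0 : has_dim [set 0 : H] 0.
Proof.
exists (fun=> 0); split; first by move=> c _ [].
apply/seteqP; split => [x ->|_ [c _ <-]]; last by rewrite big_ord0.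
by exists (fun=> 0) => //; rewrite big_ord0.
Qed.

Lemma has_dim_line v : v != 0 -> has_dim [set a *: v | a in [set: R[i]]] 1.
Proof.
move=> v0; exists (fun=> v); split.
  move=> c; rewrite big_ord1 => /eqP; rewrite scaler_eq0 (negbTE v0) orbF => /eqP c0 i.
  by rewrite ord1.
apply/seteqP; split => [_ [a _ <-]|_ [c _ <-]].
  by exists (fun=> a) => //; rewrite big_ord1.
by exists (c ord0) => //; rewrite big_ord1.
Qed.

Lemma cdot0l x : cdot (0 : H) x = 0.
Proof. by have := cdotP (-1) 0 0 x; rewrite scaler0 addr0 mulN1r addNr. Qed.

Lemma schatten_zero P (p : R) : p != 0 -> (forall x, P x = 0) -> schatten p P.
Proof.
move=> p0 P0; split.
  by apply: (@compact_rank1 _ 0) => x; exists 0; rewrite P0 scale0r.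
exists (fun=> 0).
  exists P; first by move=> x y; rewrite !P0 cdot0l cdotC cdot0l rmorph0.
  split => // l l0; exists 0%N.
    rewrite [X in has_dim X](_ : _ = [set 0]); first exact: has_dim0.
    apply/seteqP; split => x /=; rewrite !P0; last by move=> ->; rewrite scaler0.
    move/esym/eqP; rewrite scaler_eq0 => /orP[/eqP|/eqP//].
    by move=> /complexI/eqP; rewrite sqrf_eq0 gt_eqF.
  rewrite [X in (X #= _)%card](_ : _ = set0) ?II0 //.
  by apply/seteqP; split => // k /= l0'; move: l0; rewrite -l0' ltxx.
rewrite poweR_lty // eseries0 // => n _ _.
by rewrite powR0.
Qed.

(** Being idempotent and self-adjoint, [P] equals [P^* P]; its only positive eigenvalue is 1, on the
    line through [v], so the singular values are 1, 0, 0, and so on. *)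
Lemma schatten_rank1_projection P v (p : R) : p != 0 -> v != 0 -> P v = v ->
  (forall x, exists a, P x = a *: v) -> adjoint_op P P -> schatten p P.
Proof.
move=> p0 v0 Pv Pr adj.
have PP x : P (P x) = P x by have [a ->] := Pr x; rewrite bopZ Pv.
split; first exact: compact_rank1 Pr.
exists (fun n => (n == 0%N)%:R).
  exists P => //; split.
  - by move=> [|m] [|n] //=; rewrite ler_nat.
  - by move=> n; rewrite ler0n.
  move=> l l0; have [->|l1] := eqVneq l 1.
    exists 1%N.
      rewrite [X in has_dim X](_ : _ = [set a *: v | a in [set: R[i]]]).
        exact: has_dim_line.
      apply/seteqP; split => [x /=|_ [a _ <-] /=].
        by rewrite PP expr1n scale1r => <-; have [a ->] := Pr x; exists a.
      by rewrite PP bopZ Pv expr1n scale1r.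
    rewrite [X in (X #= _)%card](_ : _ = `I_1) //.
    apply/seteqP; split => [[|n]|[|n]] //= /eqP; rewrite eq_sym oner_eq0 //.
  exists 0%N.
    rewrite [X in has_dim X](_ : _ = [set 0]); first exact: has_dim0.
    have l2 : (l ^+ 2)%:C%C != 0 :> R[i].
      by apply/eqP => /complexI/eqP; rewrite sqrf_eq0 gt_eqF.
    apply/seteqP; split => x /=; last by move=> ->; rewrite !bop0 scaler0.
    (* Idempotence turns [P x = l^2 x] into [l^2 P x = P x], so [P x = 0] or [l^2 = 1]; the latter
       fails as [l] is positive and not 1. *)
    rewrite PP => Px; have := PP x; rewrite {1}Px bopZ => /eqP.
    rewrite -subr_eq0 -{2}[P x]scale1r -scalerBl scaler_eq0 => /orP[|/eqP P0].
      rewrite subr_eq0 => /eqP/complexI/eqP; rewrite sqrf_eq1 (negbTE l1) /= => /eqP l1'.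
      by move: l0; rewrite l1' oppr_gt0 ltr10.
    by move/esym/eqP: Px; rewrite P0 scaler_eq0 (negbTE l2) => /eqP.
  rewrite [X in (X #= _)%card](_ : _ = set0) ?II0 //.
  apply/seteqP; split => // -[|n] /= le; first by move: l1; rewrite -le eqxx.
  by move: l0; rewrite -le ltxx.
rewrite poweR_lty // (nneseries_split 0 1) => [|k _]; last by rewrite lee_fin powR_ge0.
rewrite eseries0 => [|n n1 _].
  by rewrite big_nat1 adde0 ltry.
by rewrite gtn_eqF //= powR0.
Qed.

End RankOne.

(** * The spaces S_p(G) *)

Section SchattenMultiplication.
Context d (T : measurableType d) (R : realType) (mu : {measure set T -> \bar R}).
Local Open Scope quotient_scope.

(** With 0 in the class, differing from [[set 0]] amounts to having a nonzero element. *)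
Lemma schatten_Linfty0 (p : R) : p != 0 -> schatten_Linfty mu p 0.
Proof.
move=> p0; apply: schatten_zero => // q.
have -> : (0 : Linfty mu) = \pi_(Linfty mu) (0 : cLfunType mu (leey 1)) by rewrite piE.
rewrite -[q]reprK /= mulLE.
have -> : (0 : L2space mu) = \pi_(L2space mu) (0 : cLfunType mu (lee1n 2)) by rewrite piE.
by apply/cLspaceP; apply/nearW => x; exact: mul0r.
Qed.

Lemma cindic_Linfty (A : set T) : measurable A -> cindic R A \in cLfun mu (leey 1).
Proof.
move=> mA; apply/cLfunP; split; first exact: cmeasurable_cindic.
rewrite /cLnorm unlock; case: ifPn => // _.
apply: (@le_lt_trans _ _ 1%E); last exact: ltry.
apply/ess_supP; apply/nearW => x.
rewrite [(abse \o _) x](_ : _ = `|(\1_A x)%:E|%E); last by rewrite -normc_cindic.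
by rewrite /= lee_fin indicE; case: (x \in A); rewrite ?normr1 ?normr0.
Qed.

Lemma cindic_class_neq0 (p : \bar R) (p1 : (1 <= p)%E) (A : set T)
    (LA : cindic R A \in cLfun mu p1) :
  measurable A -> (0 < mu A)%E -> \pi_(cLspace mu p1) (CLfun LA) != 0.
Proof.
move=> mA A0; apply/eqP.
have -> : (0 : cLspace mu p1) = \pi_(cLspace mu p1) (0 : cLfunType mu p1) by rewrite piE.
move=> /cLspaceP LA0; move: A0; rewrite (_ : mu A = 0%E) ?ltxx //.
apply/(negligibleP mu mA); apply: negligibleS LA0 => x Ax /=.
by rewrite /cindic indicE mem_set // => /complexI/eqP; rewrite oner_eq0.
Qed.

Lemma schatten_Linfty_singleton (x0 : T) (p : R) :
  p != 0 -> measurable [set x0] -> (0 < mu [set x0])%E -> (mu [set x0] < +oo)%E ->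
  exists2 f : Linfty mu, f != 0 & schatten_Linfty mu p f.
Proof.
move=> p0 mx x0_gt0 xy; pose e : T -> R[i] := cindic R [set x0].
pose F : cLfunType mu (leey 1) := CLfun (cindic_Linfty mx).
pose D : cLfunType mu (lee1n 2) := CLfun (cindic_L2 mx xy).
exists (\pi_(Linfty mu) F); first exact: cindic_class_neq0.
(* Multiplication by [e] is evaluation at [x0] times [e]; hence it has rank one and fixes the class
   of [e]. *)
have eM (h : T -> R[i]) x : e x * h x = h x0 * e x.
  rewrite /e /cindic indicE; have [->|xx0] := pselect (x = x0).
    by rewrite mem_set // mulrC.
  by rewrite memNset // mul0r mulr0.
rewrite -[schatten_Linfty _ _ _]/(schatten p (mulLop mu (\pi_(Linfty mu) F))).
apply: (@schatten_rank1_projection _ (L2space mu) _ (\pi_(L2space mu) D)) => //.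
- exact: cindic_class_neq0.
- rewrite /= mulLE; apply/cLspaceP; apply/nearW => x.
  by apply: etrans (eM e x) _; rewrite /e /cindic indicE mem_set // mul1r.
- move=> q; exists ((repr q : cLfunType mu (lee1n 2)) x0).
  rewrite -{1}[q]reprK /= mulLE cLspaceZE; apply/cLspaceP; apply/nearW => x.
  exact: eM.
- move=> q r; rewrite -[q]reprK -[r]reprK /= !mulLE.
  rewrite [LHS]L2dotE [RHS]L2dotE; apply: eq_cintegral => x /=.
  have eJ : (e x)^*%C = e x by rewrite /e /cindic /= oppr0.
  by rewrite rmorphM [X in _ = _ * (X * _)]eJ mulrCA mulrA.
Qed.

End SchattenMultiplication.

Theorem theorem2 (R : realType) (G : topologicalGroupType)
    (mu : {measure set (borelType G) -> \bar R}) (p : R)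
    (G_locally_compact : locally_compact [set: G])
    (G_hausdorff : hausdorff_space G)
    (mu_sigma_finite : sigma_finite [set: borelType G] mu)
    (mu_invariant : left_invariant mu \/ right_invariant mu)
    (p_ge1 : 1 <= p) :
  schatten_Linfty mu p <> [set 0] <->
  (exists2 c : R, 0 < c &
     forall A : set (borelType G), measurable A ->
       mu A = (c%:E * counting A)%E) /\
  countable [set: G].
Proof.
have p0 : p != 0 by rewrite gt_eqF // (lt_le_trans ltr01).
split=> [Sp0|[[c c0 muE] cG]].
  have [f f0 [cptf _]] : exists2 f : Linfty mu, f <> 0 & schatten_Linfty mu p f.
    apply: contrapT => noF; apply: Sp0; apply/seteqP; split => [f Sf|_ ->].
      by apply: contrapT => f0; apply: noF; exists f.
    exact: schatten_Linfty0.
  have [B atB] := compact_mulL_atom mu_sigma_finite f0 cptf.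
  have cG : countable [set: G] by exact: invariant_atom_countable atB.
  by split=> //; exact: invariant_atom_counting atB.
(* The identity element has mass [c], positive and finite, so its indicator gives a nonzero
   element. *)
have m1 : measurable ([set 1%g] : set (borelType G)) by exact: closed_singleton_borel.
have mu1 : mu [set 1%g] = c%:E.
  by rewrite muE // /counting asboolT // fset_set1 cardfs1 mule1.
have [|||f f0 Sf] := @schatten_Linfty_singleton _ (borelType G) R mu 1%g p p0.
- exact: m1.
- by rewrite mu1 lte_fin.
- by rewrite mu1 ltry.
by move=> S0; move: Sf; rewrite S0 /= => /eqP; apply/negP.
Qed.
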